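(* Let $L$ be a language consisting of relation symbols and unary function symbols equipped with a permutation group $\Gamma_L$. Let $\mathcal F$ be a finite family of finite $\Gamma_L$-structures and let $\mathbf A\in\mathrm{Forb}_{\mathrm{he}}(\mathcal F)$ be a finite $\Gamma_L$-structure which lies in a finite orbit of the action of $\Gamma_L$ by relabelling. If there exists a (not necessarily finite) structure $\mathbf M\in\mathrm{Forb}_{\mathrm{he}}(\mathcal F)$ containing $\mathbf A$ as a substructure such that each partial automorphism of $\mathbf A$ extends to an automorphism of $\mathbf M$, then there exists a finite structure $\mathbf B\in\mathrm{Forb}_{\mathrm{he}}(\mathcal F)$ which is an irreducible structure faithful coherent EPPA-witness for $\mathbf A$.
   Context: Structures. A language $L$ consists of relation symbols $R$ (of arity $a(R)\ge 1$) and function symbols $F$ (of arity $a(F)\ge 0$; $F$ is unary if $a(F)=1$). $L$ is equipped with a permutation group $\Gamma_L$ if $\Gamma_L$ is a group of permutations of $L$ mapping relation symbols to relation symbols and function symbols to function symbols and preserving arities. A $\Gamma_L$-structure $\mathbf A$ has a finite or countably infinite vertex set $A$, a relation $R_{\mathbf A}\subseteq A^{a(R)}$ for each relation symbol $R\in L$, and a function $F_{\mathbf A}\colon A^{a(F)}\to\mathcal P(A)$ (the power set of $A$) for each function symbol $F\in L$. It is finite if $A$ is finite. Maps. A homomorphism $f\colon\mathbf A\to\mathbf B$ is a pair $f=(f_L,f_A)$ with $f_L\in\Gamma_L$ and $f_A\colon A\to B$ such that, for all $R,F\in L$ and all tuples $\bar x$, $\bar x\in R_{\mathbf A}$ implies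 $f_A(\bar x)\in f_L(R)_{\mathbf B}$, and $f_A(F_{\mathbf A}(\bar x))\subseteq f_L(F)_{\mathbf B}(f_A(\bar x))$. It is an embedding if $f_A$ is injective, the implication is an equivalence and the inclusion is an equality. An isomorphism is an embedding with $f_A$ bijective; an automorphism is an isomorphism of a structure to itself. Maps compose componentwise (language parts and vertex parts). $\mathbf A$ is a substructure of $\mathbf B$ if $A\subseteq B$ and the pair ($\mathrm{id}_L$, inclusion) is an embedding. For an embedding $f\colon\mathbf A\to\mathbf B$, $f(\mathbf A)$ is the substructure of $\mathbf B$ with vertex set $f_A(A)$; for a vertex set $X$, $f(X)=f_A(X)$. Relabelling. For $g\in\Gamma_L$, $g\mathbf A$ is the $\Gamma_L$-structure on the vertex set $A$ with $R_{g\mathbf A}=(g^{-1}(R))_{\mathbf A}$ and $F_{g\mathbf A}=(g^{-1}(F))_{\mathbf A}$; this defines the action of $\Gamma_L$ by relabelling. Irreducibility. Given embeddings $\alpha_i\colon\mathbf A\to\mathbf B_i$ ($i=1,2$), an amalgamation of $\mathbf B_1,\mathbf B_2$ over $\mathbf A$ with respect to $\alpha_1,\alpha_2$ is a structure $\mathbf C$ with embeddings $\beta_i\colon\mathbf B_i\to\mathbf C$ such that $\beta_1\alpha_1=\beta_2\alpha_2$ (including language parts). It is strong if $\beta_1(B_1)\cap\beta_2(B_2)=\beta_1\alpha_1(A)$. A strong amalgamation is free if $C=\beta_1(B_1)\cup\beta_2(B_2)$ and whenever a tuple $\bar x$ of vertices of $\mathbf C$ contains vertices of both $\beta_1(B_1\setminus\alpha_1(A))$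 and $\beta_2(B_2\setminus\alpha_2(A))$, then $\bar x$ is in no relation of $\mathbf C$ and $F_{\mathbf C}(\bar x)=\emptyset$ for every $F\in L$ of the corresponding arity. A structure is irreducible if it is not a free amalgamation of two of its proper substructures (over a common substructure, with respect to inclusions). A homomorphism $f\colon\mathbf A\to\mathbf B$ is a homomorphism-embedding if its restriction to every irreducible substructure of $\mathbf A$ is an embedding. For a family $\mathcal F$ of $\Gamma_L$-structures, $\mathrm{Forb}_{\mathrm{he}}(\mathcal F)$ is the class of all finite or countably infinite $\Gamma_L$-structures $\mathbf A$ such that there is no $\mathbf F\in\mathcal F$ with a homomorphism-embedding $\mathbf F\to\mathbf A$. EPPA. A partial automorphism of $\mathbf A$ is an isomorphism $f$ between substructures of $\mathbf A$; its language part $f_L\in\Gamma_L$ is part of the data, and $\mathrm{dom}(f)$, $\mathrm{range}(f)$ refer to its vertex part. An automorphism $\theta$ extends $f$ if $\theta$ has the same language part as $f$ and its vertex part extends that of $f$. A finite $\mathbf B$ is an EPPA-witness for a finite $\mathbf A$ if there is an embedding $\psi\colon\mathbf A\to\mathbf B$ such that every partial automorphism of $\psi(\mathbf A)$ extends to an automorphism of $\mathbf B$. It is coherent if moreover (for this $\psi$) one can choose, for each partial automorphism $f$ of $\psi(\mathbf A)$, an automorphism $\hat f$ of $\mathbf B$ extending $f$ so that $\widehat{gf}=\hat g\hat f$ whenever $\mathrm{range}(f)=\mathrm{dom}(g)$. It is irreducible structure faithful if (for this $\psi$) for every irreducible substructure $\mathbf C$ of $\mathbf B$ there is an automorphism $g$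 of $\mathbf B$ with $g(C)\subseteq\psi(A)$. *)

(* Defs.v *)
From HB Require Import structures.
From mathcomp Require Import all_boot.
From mathcomp Require Import boolp classical_sets functions cardinality.

Set Implicit Arguments.
Unset Strict Implicit.
Unset Printing Implicit Defensive.

Local Open Scope classical_set_scope.

(* Symbols are sorted by kind and by arity, so a permutation of the language
   that preserves kinds and arities is a family of permutations of the sorts. *)
Record language := Language {
  relsym : nat -> Type;
  funsym : nat -> Type;
  relsym_arity_gt0 : relsym 0 -> False }.

Record lang_perm (L : language) := LangPerm {
  permR : forall n, relsym L n -> relsym L n;
  permF : forall n, funsym L n -> funsym L n;
  permRV : forall n, relsym L n -> relsym L n;
  permFV : forall n, funsym L n -> funsym L n;
  permRK : forall n, cancel (@permR n) (@permRV n);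
  permRVK : forall n, cancel (@permRV n) (@permR n);
  permFK : forall n, cancel (@permF n) (@permFV n);
  permFVK : forall n, cancel (@permFV n) (@permF n) }.

Definition lperm1 (L : language) : lang_perm L :=
  @LangPerm L (fun _ => id) (fun _ => id) (fun _ => id) (fun _ => id)
    (fun _ _ => erefl) (fun _ _ => erefl)
    (fun _ _ => erefl) (fun _ _ => erefl).

Definition lpermV (L : language) (g : lang_perm L) : lang_perm L :=
  LangPerm (permRVK g) (permRK g) (permFVK g) (permFK g).

Definition lpermM (L : language) (g h : lang_perm L) : lang_perm L :=
  @LangPerm L
    (fun n => permR g (n := n) \o permR h (n := n))
    (fun n => permF g (n := n) \o permF h (n := n))
    (fun n => permRV h (n := n) \o permRV g (n := n))
    (fun n => permFV h (n := n) \o permFV g (n := n))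
    (fun n => can_comp (permRK g (n := n)) (permRK h (n := n)))
    (fun n => can_comp (permRVK h (n := n)) (permRVK g (n := n)))
    (fun n => can_comp (permFK g (n := n)) (permFK h (n := n)))
    (fun n => can_comp (permFVK h (n := n)) (permFVK g (n := n))).

Record perm_group (L : language) := PermGroup {
  pg_set : set (lang_perm L);
  pg1 : pg_set (lperm1 L);
  pgM : forall g h, pg_set g -> pg_set h -> pg_set (lpermM g h);
  pgV : forall g, pg_set g -> pg_set (lpermV g) }.

(* Tuples of length n are functions from 'I_n.  The cardinality of the vertex
   type V is left free here; where it matters, V is a finType or a countType
   (finite or countably infinite). *)
Record lstruct (L : language) (V : Type) := LStruct {
  relI : forall n, relsym L n -> set ('I_n -> V);
  funI : forall n, funsym L n -> ('I_n -> V) -> set V }.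

Definition relabel (L : language) (V : Type) (g : lang_perm L)
    (A : lstruct L V) : lstruct L V :=
  LStruct (fun n R => relI A (permR (lpermV g) R))
          (fun n F => funI A (permF (lpermV g) F)).

Definition relabel_orbit (L : language) (Gam : perm_group L) (V : Type)
    (A : lstruct L V) : set (lstruct L V) :=
  [set relabel g A | g in pg_set Gam].

Record gmap (L : language) (V W : Type) := GMap {
  lpart : lang_perm L;
  vpart : V -> W }.

Definition gcomp (L : language) (U V W : Type) (g : gmap L V W)
    (f : gmap L U V) : gmap L U W :=
  GMap (lpermM (lpart g) (lpart f)) (vpart g \o vpart f).

Definition homomorphism (L : language) (Gam : perm_group L) (V W : Type)
    (A : lstruct L V) (B : lstruct L W) (f : gmap L V W) : Prop :=
  [/\ pg_set Gam (lpart f),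
      (forall n (R : relsym L n) (x : 'I_n -> V),
         relI A R x -> relI B (permR (lpart f) R) (vpart f \o x)) &
      (forall n (F : funsym L n) (x : 'I_n -> V),
         vpart f @` funI A F x
           `<=` funI B (permF (lpart f) F) (vpart f \o x))].

Definition embedding (L : language) (Gam : perm_group L) (V W : Type)
    (A : lstruct L V) (B : lstruct L W) (f : gmap L V W) : Prop :=
  [/\ homomorphism Gam A B f,
      injective (vpart f),
      (forall n (R : relsym L n) (x : 'I_n -> V),
         relI A R x <-> relI B (permR (lpart f) R) (vpart f \o x)) &
      (forall n (F : funsym L n) (x : 'I_n -> V),
         vpart f @` funI A F x
           = funI B (permF (lpart f) F) (vpart f \o x))].

Definition isomorphism (L : language) (Gam : perm_group L) (V W : Type)
    (A : lstruct L V) (B : lstruct L W) (f : gmap L V W) : Prop :=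
  embedding Gam A B f /\ bijective (vpart f).

Definition automorphism (L : language) (Gam : perm_group L) (V : Type)
    (A : lstruct L V) (f : gmap L V V) : Prop :=
  isomorphism Gam A A f.

(* The only structure on the vertex set X for which the inclusion in A can be
   an embedding; it is one exactly when X is closed under the functions of A. *)
Definition induced (L : language) (V : Type) (A : lstruct L V) (X : set V) :
    lstruct L X :=
  @LStruct L X
    (fun n R (x : 'I_n -> X) => relI A R (fun i => val (x i)))
    (fun n F (x : 'I_n -> X) =>
       [set y : X | funI A F (fun i => val (x i)) (val y)]).

Definition inclusion (L : language) (V : Type) (X : set V) : gmap L X V :=
  GMap (lperm1 L) (fun x : X => val x).

Definition substructure (L : language) (Gam : perm_group L) (V : Type)
    (A : lstruct L V) (X : set V) : Prop :=
  embedding Gam (induced A X) A (inclusion L X).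

Definition inclusion2 (L : language) (V : Type) (X Y : set V)
    (XY : X `<=` Y) : gmap L X Y :=
  GMap (lperm1 L)
    (fun x : X => exist _ (val x) (mem_set (XY _ (set_valP x))) : Y).

Definition amalgamation (L : language) (Gam : perm_group L)
    (VA V1 V2 VC : Type) (A : lstruct L VA) (B1 : lstruct L V1)
    (B2 : lstruct L V2) (a1 : gmap L VA V1) (a2 : gmap L VA V2)
    (C : lstruct L VC) (b1 : gmap L V1 VC) (b2 : gmap L V2 VC) : Prop :=
  (embedding Gam A B1 a1 /\ embedding Gam A B2 a2) /\
  [/\ embedding Gam B1 C b1, embedding Gam B2 C b2 &
      gcomp b1 a1 = gcomp b2 a2].

Definition strong_amalgamation (L : language) (Gam : perm_group L)
    (VA V1 V2 VC : Type) (A : lstruct L VA) (B1 : lstruct L V1)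
    (B2 : lstruct L V2) (a1 : gmap L VA V1) (a2 : gmap L VA V2)
    (C : lstruct L VC) (b1 : gmap L V1 VC) (b2 : gmap L V2 VC) : Prop :=
  amalgamation Gam A B1 B2 a1 a2 C b1 b2 /\
  range (vpart b1) `&` range (vpart b2) = range (vpart (gcomp b1 a1)).

Definition straddles (L : language) (VA V1 V2 VC : Type)
    (a1 : gmap L VA V1) (a2 : gmap L VA V2)
    (b1 : gmap L V1 VC) (b2 : gmap L V2 VC) (n : nat) (x : 'I_n -> VC) : Prop :=
  (exists i, (vpart b1 @` (~` range (vpart a1))) (x i)) /\
  (exists j, (vpart b2 @` (~` range (vpart a2))) (x j)).

Definition free_amalgamation (L : language) (Gam : perm_group L)
    (VA V1 V2 VC : Type) (A : lstruct L VA) (B1 : lstruct L V1)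
    (B2 : lstruct L V2) (a1 : gmap L VA V1) (a2 : gmap L VA V2)
    (C : lstruct L VC) (b1 : gmap L V1 VC) (b2 : gmap L V2 VC) : Prop :=
  [/\ strong_amalgamation Gam A B1 B2 a1 a2 C b1 b2,
      range (vpart b1) `|` range (vpart b2) = setT &
      (forall n (x : 'I_n -> VC), straddles a1 a2 b1 b2 x ->
         (forall R : relsym L n, ~ relI C R x) /\
         (forall F : funsym L n, funI C F x = set0))].

Definition irreducible (L : language) (Gam : perm_group L) (V : Type)
    (C : lstruct L V) : Prop :=
  ~ exists (X0 X1 X2 : set V) (X01 : X0 `<=` X1) (X02 : X0 `<=` X2),
      [/\ [/\ substructure Gam C X0, substructure Gam C X1 &
              substructure Gam C X2],
          X1 <> setT, X2 <> setT &
          free_amalgamation Gam (induced C X0) (induced C X1) (induced C X2)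
            (inclusion2 L X01) (inclusion2 L X02)
            C (inclusion L X1) (inclusion L X2)].

Definition hom_embedding (L : language) (Gam : perm_group L) (V W : Type)
    (A : lstruct L V) (B : lstruct L W) (f : gmap L V W) : Prop :=
  homomorphism Gam A B f /\
  forall X : set V, substructure Gam A X -> irreducible Gam (induced A X) ->
    embedding Gam (induced A X) B (gcomp f (inclusion L X)).

Definition Forb_he (L : language) (Gam : perm_group L) (I : Type)
    (VF : I -> countType) (Fam : forall i, lstruct L (VF i))
    (V : countType) (A : lstruct L V) : Prop :=
  forall i, ~ exists f : gmap L (VF i) V, hom_embedding Gam (Fam i) A f.

(* The domain X and the range Y are indices of the type of f, so that partial
   automorphisms with range(f) = dom(g) compose by gcomp. *)
Definition partial_aut (L : language) (Gam : perm_group L) (V : Type)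
    (A : lstruct L V) (X Y : set V) (f : gmap L X Y) : Prop :=
  [/\ substructure Gam A X, substructure Gam A Y &
      isomorphism Gam (induced A X) (induced A Y) f].

(* The set V of vertices is identified with a subset of W by the map i. *)
Definition extends (L : language) (V W : Type) (i : V -> W) (X Y : set V)
    (f : gmap L X Y) (t : gmap L W W) : Prop :=
  lpart t = lpart f /\
  forall x : X, vpart t (i (val x)) = i (val (vpart f x)).

Definition extends_partial_auts (L : language) (Gam : perm_group L)
    (V W : Type) (A : lstruct L V) (M : lstruct L W) (i : V -> W) : Prop :=
  forall (X Y : set V) (f : gmap L X Y), partial_aut Gam A f ->
    exists t : gmap L W W, automorphism Gam M t /\ extends i f t.

Definition image_struct (L : language) (V W : Type) (B : lstruct L W)
    (psi : gmap L V W) : lstruct L (range (vpart psi)) :=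
  induced B (range (vpart psi)).

Definition eppa_via (L : language) (Gam : perm_group L) (V W : Type)
    (A : lstruct L V) (B : lstruct L W) (psi : gmap L V W) : Prop :=
  embedding Gam A B psi /\
  extends_partial_auts Gam (image_struct B psi) B
    (fun y : range (vpart psi) => val y).

Definition coherent_via (L : language) (Gam : perm_group L) (V W : Type)
    (B : lstruct L W) (psi : gmap L V W) : Prop :=
  let P := range (vpart psi) in
  exists hat : forall X Y : set P, gmap L X Y -> gmap L W W,
    (forall (X Y : set P) (f : gmap L X Y),
       partial_aut Gam (image_struct B psi) f ->
       automorphism Gam B (hat X Y f) /\
       extends (fun y : P => val y) f (hat X Y f)) /\
    (forall (X Y Z : set P) (f : gmap L X Y) (g : gmap L Y Z),
       partial_aut Gam (image_struct B psi) f ->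
       partial_aut Gam (image_struct B psi) g ->
       hat X Z (gcomp g f) = gcomp (hat Y Z g) (hat X Y f)).

Definition irr_faithful_via (L : language) (Gam : perm_group L) (V W : Type)
    (B : lstruct L W) (psi : gmap L V W) : Prop :=
  forall X : set W, substructure Gam B X -> irreducible Gam (induced B X) ->
    exists g : gmap L W W,
      automorphism Gam B g /\ vpart g @` X `<=` range (vpart psi).

Definition irr_faithful_coherent_eppa_witness (L : language)
    (Gam : perm_group L) (V W : finType) (A : lstruct L V)
    (B : lstruct L W) : Prop :=
  exists psi : gmap L V W,
    [/\ eppa_via Gam A B psi, coherent_via Gam B psi &
        irr_faithful_via Gam B psi].

(* Main.v *)
Require Import Defs.
From mathcomp Require Import boolp classical_sets functions cardinality.
From mathcomp Require Import all_boot all_fingroup.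

(* A cover of A is a finite set of points on which labelled symmetries act and
   which contains the images (copies) of one chart V -> points; two copies
   overlap in a partial automorphism of A, and partial automorphisms of A extend
   coherently to symmetries. The structure B is the union of the copies.

   In the first cover a symmetry carries, modulo 2, the chain of moves by partial
   automorphisms that produced it. If that chain only uses moves carrying a set
   X, then its end points are joined by such moves, and so the symmetry induces
   a partial automorphism on X.

   A cover is refined by giving each point a colour for every relation r which,
   on each copy, is the kernel of a colouring with a fixed number of colours.
   Call two points adjacent if they lie in a common copy. When r is the equality
   on a clique that lies in no copy, the colours prevent the clique from lifting,
   so that finitely many refinements put every clique into a copy. This gives
   irreducible structure faithfulness. With two colours, enough refinements make
   every small set of points project to a level at which the last refinement
   did not change its adjacency graph. That graph is then chordal, hence glued
   from cliques along cliques, and the set can be mapped to M copy by copy. So a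
   homomorphism-embedding F -> B would give one F -> M. *)

Set Implicit Arguments.
Unset Strict Implicit.
Unset Printing Implicit Defensive.

(** * Coherent extensions and partial isomorphisms *)

Section PermOf.
Variable T : finType.
Local Open Scope group_scope.
Implicit Types (X : {set T}) (q : T -> T).

(** Maps that are not injective get the junk value 1, so no proof of injectivity is part of the data
    and pointwise equal maps give equal permutations. *)
Definition injperm (f : T -> T) : {perm T} := insubd (1 : {perm T}) (finfun f).

Lemma injpermE f : injective f -> injperm f =1 f.
Proof.
move=> finj x; rewrite /injperm -pvalE insubdK ?ffunE //.
rewrite unfold_in; apply/injectiveP => a b; rewrite !ffunE; exact: finj.
Qed.

Lemma eq_injperm f g : f =1 g -> injperm f = injperm g.
Proof. by move=> fg; congr insubd; apply/ffunP => x; rewrite !ffunE. Qed.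

(* Matching the complements by rank in the enumeration of T makes the extension
   of partial injections functorial. *)
Definition coext (X : {set T}) (q : T -> T) (x : T) : T :=
  if x \in X then q x
  else nth x (enum (~: (q @: X))) (index x (enum (~: X))).

Lemma coext_card X q : {in X &, injective q} ->
  size (enum (~: (q @: X))) = size (enum (~: X)).
Proof. by move=> qi; rewrite -!cardE [LHS]cardsCs [RHS]cardsCs !setCK card_in_imset. Qed.

Lemma coext_out X q x : {in X &, injective q} -> x \notin X ->
  coext X q x \notin q @: X /\
  index (coext X q x) (enum (~: (q @: X))) = index x (enum (~: X)).
Proof.
move=> qi xX; rewrite /coext (negbTE xX).
have lt : index x (enum (~: X)) < size (enum (~: (q @: X))).
  by rewrite coext_card // index_mem mem_enum inE.
split; last by rewrite index_uniq // enum_uniq.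
by have := mem_nth x lt; rewrite mem_enum inE.
Qed.

Lemma coext_in X q x : x \in X -> coext X q x = q x.
Proof. by rewrite /coext => ->. Qed.

Lemma coext_inj X q : {in X &, injective q} -> injective (coext X q).
Proof.
move=> qi x y.
have [xX|xX] := boolP (x \in X); have [yX|yX] := boolP (y \in X).
- by rewrite !coext_in //; apply: qi.
- move=> e; have [] := coext_out qi yX.
  by rewrite -e coext_in // imset_f.
- move=> e; have [] := coext_out qi xX.
  by rewrite e coext_in // imset_f.
move=> e; have [_ ix] := coext_out qi xX; have [_ iy] := coext_out qi yX.
have : index x (enum (~: X)) = index y (enum (~: X)) by rewrite -ix -iy e.
move=> /(congr1 (nth x (enum (~: X)))).
by rewrite !nth_index // mem_enum inE.
Qed.

Lemma eq_coext X q q' : {in X, q =1 q'} -> coext X q =1 coext X q'.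
Proof. by move=> e x; rewrite /coext (eq_in_imset e); case: ifP => // /e. Qed.

Lemma coext_comp X q1 q2 : {in X &, injective q1} ->
  {in q1 @: X &, injective q2} ->
  coext X (q2 \o q1) =1 coext (q1 @: X) q2 \o coext X q1.
Proof.
move=> i1 i2 x /=; have [xX|xX] := boolP (x \in X).
  by rewrite !coext_in //= imset_f.
have [n1 e1] := coext_out i1 xX.
rewrite {2}/coext (negbTE n1) e1 {1}/coext (negbTE xX) imset_comp.
(* The two sides differ only in the default value of [nth], which is not reached because all the
   complements have the same size. *)
apply: set_nth_default; rewrite coext_card // coext_card // index_mem.
by rewrite mem_enum inE.
Qed.

Definition coextp X q := injperm (coext X q).

Lemma coextpE X q x : {in X &, injective q} -> x \in X -> coextp X q x = q x.
Proof.
by move=> qi xX; rewrite injpermE ?coext_in //; apply: coext_inj.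
Qed.

Lemma eq_coextp X q q' : {in X, q =1 q'} -> coextp X q = coextp X q'.
Proof. by move=> /eq_coext/eq_injperm. Qed.

Lemma coextp_comp X q1 q2 : {in X &, injective q1} ->
  {in q1 @: X &, injective q2} ->
  coextp X (q2 \o q1) = coextp X q1 * coextp (q1 @: X) q2.
Proof.
move=> i1 i2; apply/permP => x; rewrite permM !injpermE; first last.
- by apply: coext_inj => a b aX bX /= /i2 e; apply: i1 => //; apply: e; rewrite imset_f.
- exact: coext_inj.
- exact: coext_inj.
exact: coext_comp.
Qed.

End PermOf.

(** * Matching two colourings with the same kernel *)

Section ColourMatch.
Variables T C : finType.
Implicit Types (K : {set T}) (a b c : T -> C).
Local Open Scope group_scope.

(** When [a] and [b] have the same kernel on K, the choice of u is immaterial and a(u) goes to b(u).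
    The canonical extension off a(K) makes the matching functorial. *)
Definition colmatch K a b : {perm C} :=
  coextp (a @: K) (fun x => if [pick u in K | a u == x] is Some u then b u else x).

Definition same_kernel K a b :=
  {in K &, forall u v, (a u == a v) = (b u == b v)}.

Lemma colmatch_pick K a b : same_kernel K a b -> {in K, forall u,
  (if [pick v in K | a v == a u] is Some v then b v else a u) = b u}.
Proof.
move=> ab u uK; case: pickP => [v /andP[vK e]|/(_ u)]; last by rewrite uK eqxx.
by apply/eqP; rewrite -ab.
Qed.

Lemma colmatch_inj K a b : same_kernel K a b -> {in a @: K &, injective
  (fun x => if [pick u in K | a u == x] is Some u then b u else x)}.
Proof.
move=> ab _ _ /imsetP[u uK ->] /imsetP[v vK ->].
by rewrite !(colmatch_pick ab) // => /eqP; rewrite -ab // => /eqP.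
Qed.

Lemma colmatchE K a b : same_kernel K a b ->
  {in K, forall u, colmatch K a b (a u) = b u}.
Proof.
move=> ab u uK; rewrite /colmatch coextpE ?imset_f //.
  exact: colmatch_pick.
exact: colmatch_inj.
Qed.

Lemma colmatch_comp K a b c : same_kernel K a b -> same_kernel K b c ->
  colmatch K a c = colmatch K a b * colmatch K b c.
Proof.
move=> ab bc; have ac : same_kernel K a c by move=> u v uK vK; rewrite ab // bc.
rewrite /colmatch; set f := (fun x => if [pick u in K | a u == x] is Some u then b u else x).
have im : b @: K = f @: (a @: K).
  by rewrite -imset_comp; apply: eq_in_imset => u uK; rewrite /f /= colmatch_pick.
rewrite im -coextp_comp -?im.
- apply: eq_coextp => _ /imsetP[u uK ->]; rewrite /= /f.
  by rewrite !colmatch_pick.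
- exact: colmatch_inj.
- exact: colmatch_inj.
Qed.

Lemma colmatch_imset K a b (s : T -> T) : same_kernel (s @: K) a b ->
  colmatch (s @: K) a b = colmatch K (a \o s) (b \o s).
Proof.
move=> ab; rewrite /colmatch imset_comp; apply: eq_coextp.
move=> _ /imsetP[_ /imsetP[u uK ->] ->].
rewrite colmatch_pick ?imset_f //.
have ab' : same_kernel K (a \o s) (b \o s).
  by move=> v w vK wK; rewrite /= ab ?imset_f.
by rewrite (colmatch_pick ab').
Qed.

End ColourMatch.

Section LangPerm.
Variable L : language.

Lemma lang_perm_ext (g h : lang_perm L) :
  permR g = permR h -> permF g = permF h ->
  permRV g = permRV h -> permFV g = permFV h -> g = h.
Proof.
case: g h => [a b c d ? ? ? ?] [a' b' c' d' ? ? ? ?] /= *; subst.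
by f_equal; apply: Prop_irrelevance.
Qed.

Lemma lpermMA (f g h : lang_perm L) :
  lpermM f (lpermM g h) = lpermM (lpermM f g) h.
Proof. by apply: lang_perm_ext. Qed.

Lemma lperm1M (g : lang_perm L) : lpermM (lperm1 L) g = g.
Proof. by apply: lang_perm_ext. Qed.

Lemma lpermM1 (g : lang_perm L) : lpermM g (lperm1 L) = g.
Proof. by apply: lang_perm_ext. Qed.

Lemma lpermMV (g : lang_perm L) : lpermM g (lpermV g) = lperm1 L.
Proof.
apply: lang_perm_ext; apply: functional_extensionality_dep => n;
  apply: funext => x /=.
- exact: permRVK.
- exact: permFVK.
- exact: permRVK.
- exact: permFVK.
Qed.

Lemma lpermVK (g : lang_perm L) : lpermV (lpermV g) = g.
Proof. by apply: lang_perm_ext. Qed.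

Lemma lpermVM (g : lang_perm L) : lpermM (lpermV g) g = lperm1 L.
Proof. by rewrite -{2}[g]lpermVK lpermMV. Qed.

Lemma lpermMVr (g h : lang_perm L) : lpermM g (lpermM (lpermV g) h) = h.
Proof. by rewrite lpermMA lpermMV lperm1M. Qed.

Lemma relabelM (V : Type) (A : lstruct L V) g h :
  relabel (lpermM g h) A = relabel g (relabel h A).
Proof. by []. Qed.

Lemma relabel1 (V : Type) (A : lstruct L V) : relabel (lperm1 L) A = A.
Proof. by case: A. Qed.

Lemma relabelVK (V : Type) (A : lstruct L V) g :
  relabel (lpermV g) (relabel g A) = A.
Proof. by rewrite -relabelM lpermVM relabel1. Qed.

End LangPerm.

(** * Partial isomorphisms between structures on V *)

Section PartialIso.
Variables (L : language) (V : finType).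
Implicit Types (A B C : lstruct L V) (X Y Z : {set V}).

Definition funclosed A X := forall n (F : funsym L n) (x : 'I_n -> V) y,
  (forall i, x i \in X) -> funI A F x y -> y \in X.

(** Only the values of [q] on X matter. The language part is the identity: a partial isomorphism
    with language part g starts from [relabel g A] instead of A. *)
Record piso A B X (q : V -> V) : Prop := Piso {
  piso_closed : funclosed A X;
  piso_inj : {in X &, injective q};
  piso_rel : forall n (R : relsym L n) (x : 'I_n -> V),
    (forall i, x i \in X) -> (relI A R x <-> relI B R (q \o x));
  piso_fun : forall n (F : funsym L n) (x : 'I_n -> V) y,
    (forall i, x i \in X) -> funI A F x y -> funI B F (q \o x) (q y);
  piso_funV : forall n (F : funsym L n) (x : 'I_n -> V) z,
    (forall i, x i \in X) -> funI B F (q \o x) z ->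
    exists2 y, funI A F x y & z = q y }.

Lemma funclosed_relabel A g X : funclosed A X <-> funclosed (relabel g A) X.
Proof.
split=> c n F x y xX; first exact: c.
by have := c n (permF g F) x y xX; rewrite /= permFK.
Qed.

Lemma piso_id A X : funclosed A X -> piso A A X id.
Proof. by move=> c; split=> // n F x z xX Fz; exists z. Qed.

Lemma piso_sub A B X Y q : Y \subset X -> funclosed A Y ->
  piso A B X q -> piso A B Y q.
Proof.
move=> /subsetP YX c [_ i r f fV]; split=> //.
- by move=> a b /YX aX /YX bX; apply: i.
- by move=> n R x xY; apply: r => j; apply: YX.
- by move=> n F x y xY; apply: f => j; apply: YX.
- by move=> n F x z xY; apply: fV => j; apply: YX.
Qed.

Lemma eq_piso A B X q q' : {in X, q =1 q'} -> piso A B X q -> piso A B X q'.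
Proof.
move=> e [c i r f fV].
have ex n (x : 'I_n -> V) : (forall j, x j \in X) -> q' \o x = q \o x.
  by move=> xX; apply: funext => j /=; rewrite e.
split=> //.
- by move=> a b aX bX; rewrite -!e //; apply: i.
- by move=> n R x xX; rewrite ex //; apply: r.
- by move=> n F x y xX Fy; rewrite ex // -e //; [apply: f|apply: c Fy].
- move=> n F x z xX; rewrite ex // => /fV[] // y Fy ->.
  by exists y; rewrite ?e //; apply: c Fy.
Qed.

Lemma piso_comp A B C X q1 q2 :
  piso A B X q1 -> piso B C (q1 @: X) q2 -> piso A C X (q2 \o q1).
Proof.
move=> [c1 i1 r1 f1 fV1] [c2 i2 r2 f2 fV2].
have im n (x : 'I_n -> V) : (forall j, x j \in X) ->
    forall j, (q1 \o x) j \in q1 @: X by move=> xX j; apply: imset_f.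
split=> //.
- by move=> a b aX bX /= e; apply: i1 => //; apply: i2 => //; apply: imset_f.
- by move=> n R x xX; rewrite r1 // r2 //; apply: im.
- by move=> n F x y xX Fy; apply: f2; [apply: im|apply: f1].
- move=> n F x z xX /fV2[|y /fV1[]// y' Fy' -> ->]; first exact: im.
  by exists y'.
Qed.

Lemma piso_im_closed A B X q : piso A B X q -> funclosed B (q @: X).
Proof.
move=> [c i r f fV] n F x z xX Fz.
have h j : exists y, y \in X /\ x j = q y.
  by have /imsetP[y] := xX j; exists y.
have [x' hx'] := choice h.
have ex : x = q \o x' by apply: funext => j; case: (hx' j).
have x'X j : x' j \in X by case: (hx' j).
move: Fz; rewrite ex => /fV[] // y Fy ->.
by rewrite imset_f //; apply: c Fy.
Qed.

Lemma piso_relabel g A B X q :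
  piso A B X q -> piso (relabel g A) (relabel g B) X q.
Proof.
move=> [c i r f fV]; split=> //.
- by rewrite -funclosed_relabel.
- by move=> n R x xX; apply: r.
- by move=> n F x y xX; apply: f.
- by move=> n F x z xX; apply: fV.
Qed.

Local Open Scope group_scope.

Lemma piso_inv A B X (s : {perm V}) :
  piso A B X s -> piso B A (s @: X) (s^-1)%g.
Proof.
move=> p; have c' := piso_im_closed p; case: p => [c i r f fV].
have mem x : (x \in s @: X) = ((s^-1)%g x \in X).
  by rewrite -{1}[x](permKV s) mem_imset //; apply: perm_inj.
have ex n (x : 'I_n -> V) : x = s \o ((s^-1)%g \o x).
  by apply: funext => j /=; rewrite permKV.
split=> //.
- by move=> a b _ _; apply: perm_inj.
- move=> n R x xX; rewrite {1}(ex _ x) -r // => j.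
  by rewrite -mem.
- move=> n F x y xX; rewrite {1}(ex _ x) => /fV[j|z Fz ->]; first by rewrite -mem.
  by rewrite permK.
- move=> n F x z xX Fz; exists (s z); last by rewrite permK.
  by rewrite (ex _ x); apply: f => // j; rewrite -mem.
Qed.

End PartialIso.

(** * Closures of points *)

Section Closure.
Variables (L : language) (V : finType) (A : lstruct L V).
Implicit Types (X Y : {set V}) (x y : V).

Definition cl x : {set V} :=
  [set y | `[< forall X, funclosed A X -> x \in X -> y \in X >]].

Lemma cl_self x : x \in cl x.
Proof. by rewrite inE; apply/asboolP. Qed.

Lemma cl_sub X x : funclosed A X -> x \in X -> cl x \subset X.
Proof. by move=> c xX; apply/subsetP => y; rewrite inE => /asboolP; apply. Qed.

Lemma cl_closed x : funclosed A (cl x).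
Proof.
move=> n F t y tX Fy; rewrite inE; apply/asboolP => X c xX.
by apply: (c _ _ _ _ _ Fy) => i; apply: (subsetP (cl_sub c xX)).
Qed.

Lemma cl_trans x y : y \in cl x -> cl y \subset cl x.
Proof. by apply: cl_sub; apply: cl_closed. Qed.

Hypothesis L_unary : forall n, funsym L n -> n = 1.

(** A unary function applied at a point takes its values in the closure of that point, so closedness
    can be checked one point at a time. *)
Lemma funclosedP X : (forall x, x \in X -> cl x \subset X) -> funclosed A X.
Proof.
move=> h n F t y tX Fy; have n1 := L_unary F; move: F t tX Fy; rewrite n1.
move=> F t tX Fy; apply: (subsetP (h _ (tX ord0))).
apply: cl_closed Fy => i; rewrite ord1; exact: cl_self.
Qed.

(** The image of [cl x] is closed and contains q(x); conversely, the points of X that [q] sends into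
    [cl (q x)] form a closed set containing x. *)
Lemma piso_cl g X q x : x \in X ->
  piso (relabel g A) A X q -> q @: cl x = cl (q x).
Proof.
move=> xX p; have [c i r f fV] := p.
have cX : funclosed A X by rewrite funclosed_relabel; exact: c.
have sX := cl_sub cX xX.
apply/eqP; rewrite eqEsubset; apply/andP; split; last first.
  apply: cl_sub; last by rewrite imset_f ?cl_self.
  apply: piso_im_closed (piso_sub sX _ p).
  by rewrite -funclosed_relabel; apply: cl_closed.
suff : cl x \subset [set y in X | q y \in cl (q x)].
  move=> /subsetP s; apply/subsetP => _ /imsetP[y yx ->].
  by have := s _ yx; rewrite inE => /andP[].
apply: cl_sub; last by rewrite inE xX cl_self.
move=> n F t y tX Fy.
have tX' j : t j \in X by have := tX j; rewrite inE => /andP[].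
have Fy' : funI (relabel g A) (permF g F) t y by rewrite /= permFK.
rewrite inE; apply/andP; split; first by apply: c Fy'.
apply: cl_closed (f _ _ _ _ tX' Fy') => j.
by have := tX j; rewrite inE => /andP[].
Qed.

End Closure.

(** * Covers, and a first cover *)

Lemma imset_permM (T : finType) (X : {set T}) (s t : {perm T}) :
  (s * t)%g @: X = t @: (s @: X).
Proof. by rewrite -imset_comp; apply: eq_imset => x; rewrite permM. Qed.

Lemma imset_perm1 (T : finType) (X : {set T}) : (1 : {perm T})%g @: X = X.
Proof. by rewrite -[RHS]imset_id; apply: eq_imset => x; rewrite perm1. Qed.

Section Systems.
Variables (L : language) (Gam : perm_group L) (V : finType) (A : lstruct L V).
Local Open Scope group_scope.
Implicit Types (X Y : {set V}) (q : V -> V).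

Definition pa g X q := pg_set Gam g /\ piso (relabel g A) A X q.

Lemma pa_closed g X q : pa g X q -> funclosed A X.
Proof. by case=> _ [c _ _ _ _]; rewrite funclosed_relabel; exact: c. Qed.

Lemma pa_inj g X q : pa g X q -> {in X &, injective q}.
Proof. by case=> _ []. Qed.

Lemma pa_sub g X Y q : Y \subset X -> funclosed A Y -> pa g X q -> pa g Y q.
Proof.
by move=> YX cY [gG p]; split=> //; apply: piso_sub p => //;
  rewrite -funclosed_relabel.
Qed.

Lemma eq_pa g X q q' : {in X, q =1 q'} -> pa g X q -> pa g X q'.
Proof. by move=> e [gG p]; split=> //; apply: eq_piso p. Qed.

(* [hat X s g] extends the partial automorphism of A with domain X and label g
   that the permutation s induces. *)
Record system := System {
  pt :> finType;
  sym : lang_perm L -> {perm pt} -> Prop;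
  chart : V -> pt;
  hat : {set V} -> {perm V} -> lang_perm L -> {perm pt};
  symG : forall g h, sym g h -> pg_set Gam g;
  sym1 : sym (lperm1 L) 1;
  symM : forall g1 g2 h1 h2, sym g1 h1 -> sym g2 h2 ->
    sym (lpermM g2 g1) (h1 * h2);
  symV : forall g h, sym g h -> sym (lpermV g) h^-1;
  chart_inj : injective chart;
  sym_pa : forall g h, sym g h ->
    let X := [set x | [exists y, h (chart x) == chart y]] in
    exists2 q, pa g X q & {in X, forall x, h (chart x) = chart (q x)};
  hat_sym : forall g X (s : {perm V}), pa g X s -> sym g (hat X s g);
  hatE : forall g X (s : {perm V}), pa g X s ->
    {in X, forall x, hat X s g (chart x) = chart (s x)};
  hatM : forall g1 g2 X (s1 s2 : {perm V}), pa g1 X s1 -> pa g2 (s1 @: X) s2 ->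
    hat X (s1 * s2) (lpermM g2 g1) = hat X s1 g1 * hat (s1 @: X) s2 g2 }.

End Systems.

Section Orbit.
Variables (L : language) (Gam : perm_group L) (V : finType) (A : lstruct L V).
Hypothesis A_orbit : finite_set (relabel_orbit Gam A).

(** [Gam] may be infinite, but on the finite orbit of A it acts through a finite permutation group.
    The permutations of the first cover depend on a label only through this action. *)
Lemma orbit_code : exists (O : finType) (dec : O -> lstruct L V) (o0 : O)
    (lab : lang_perm L -> {perm O}),
  [/\ injective dec, dec o0 = A &
      forall g o, pg_set Gam g -> dec (lab g o) = relabel g (dec o)].
Proof.
have [n /card_set_bijP[f [fI finj fs]]] := A_orbit.
have decP (o : 'I_n) : exists S, relabel_orbit Gam A S /\ f S = o.
  by have [S ? ?] := fs o (ltn_ord o); exists S.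
have [dec decE] := choice decP.
have cod S : relabel_orbit Gam A S -> exists o, dec o = S.
  move=> oS; have fS : (f S < n)%N by apply: fI.
  exists (Ordinal fS); have [od fd] := decE (Ordinal fS).
  by apply: finj fd; apply: mem_set.
have dinj : injective dec.
  move=> a b e; have [_ ea] := decE a; have [_ eb] := decE b.
  by apply: val_inj; rewrite /= -ea -eb e.
have orb g o : pg_set Gam g -> relabel_orbit Gam A (relabel g (dec o)).
  move=> gG; have [[h hG <-] _] := decE o.
  by exists (lpermM g h) => //; apply: pgM.
have labP go : exists o', pg_set Gam go.1 -> dec o' = relabel go.1 (dec go.2).
  case: (pselect (pg_set Gam go.1)) => [gG|nG]; last by exists go.2.
  by have [o' e] := cod _ (orb _ go.2 gG); exists o'.
have [l lE] := choice labP.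
have [o0 eo0] : exists o, dec o = A.
  apply: cod; exists (lperm1 L); [exact: pg1|exact: relabel1].
exists ('I_n : finType), dec, o0, (fun g => injperm (fun o => l (g, o))); split=> //.
move=> g o gG; rewrite injpermE; first exact: (lE (g, o)).
move=> a b e; apply: dinj.
have := congr1 dec e; rewrite (lE (g, a)) // (lE (g, b)) //= => eg.
by rewrite -(relabelVK (dec a) g) eg relabelVK.
Qed.

End Orbit.

(** * The first cover, built from chains of moves modulo 2 *)

Section BaseSystem.
Variables (L : language) (Gam : perm_group L) (V : finType) (A : lstruct L V).
Hypothesis L_unary : forall n, funsym L n -> n = 1.
Variables (O : finType) (dec : O -> lstruct L V) (o0 : O).
Variable lab : lang_perm L -> {perm O}.
Hypotheses (dec_inj : injective dec) (dec0 : dec o0 = A).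
Hypothesis labE : forall g o, pg_set Gam g -> dec (lab g o) = relabel g (dec o).
Local Open Scope group_scope.

(** A node (s0, o) stands for the structure that s0 transports from [dec o] to V. A move joins two
    nodes whose structures agree on a set closed in both, and ((s0, o), X) is the half-edge at (s0,
    o) of a move through s0(X). *)
Let node := ({perm V} * O)%type.
Let edge := (node * {set V})%type.
Implicit Types (e : edge) (C X : {set V}) (s t : {perm V}) (r : {perm O}).

Lemma lab1 : lab (lperm1 L) = 1.
Proof.
by apply/permP => o; apply: dec_inj; rewrite labE ?relabel1 ?perm1 //; apply: pg1.
Qed.

Lemma labM g h : pg_set Gam g -> pg_set Gam h ->
  lab (lpermM g h) = lab h * lab g.
Proof.
move=> gG hG; apply/permP => o; apply: dec_inj.
by rewrite permM !labE //; apply: pgM.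
Qed.

Lemma labV g : pg_set Gam g -> lab (lpermV g) = (lab g)^-1.
Proof.
move=> gG; apply/esym/eqP; rewrite eq_invg_mul -labM ?lpermVM ?lab1 //.
exact: pgV.
Qed.

Definition eact s r e : edge := ((e.1.1 * s, r e.1.2), e.2).

Lemma eactM s t r r' e : eact t r' (eact s r e) = eact (s * t) (r * r') e.
Proof. by rewrite /eact /= mulgA permM. Qed.

Lemma eact1 e : eact 1 1 e = e.
Proof. by case: e => [[s o] X]; rewrite /eact /= mulg1 perm1. Qed.

Lemma eactK s r : cancel (eact s r) (eact s^-1 r^-1).
Proof. by move=> e; rewrite eactM !mulgV eact1. Qed.

Lemma eactKV s r : cancel (eact s^-1 r^-1) (eact s r).
Proof. by move=> e; rewrite eactM !mulVg eact1. Qed.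

Definition carried C e := C \subset e.1.1 @: e.2.

Lemma carried_act s r C e : carried (s @: C) (eact s r e) = carried C e.
Proof.
case: e => [[s0 o] X]; rewrite /carried /=.
rewrite imset_permM.
apply/subsetP/subsetP => h x xC.
  have /h/imsetP[y yX /perm_inj->//] : s x \in s @: C by apply: imset_f.
by case/imsetP: xC => y /h yX ->; apply: imset_f.
Qed.

Let bpt := (V * {set V} * {ffun edge -> bool})%type.

(** The chain [a] is added to the recorded one only on the half-edges that do not carry the set
    stored in the point. A chart point can therefore return to the chart only if every half-edge of
    [a] carries its transported closure. *)
Definition bact (a : edge -> bool) s r (p : bpt) : bpt :=
  ((s p.1.1, s @: p.1.2),
   [ffun e => p.2 (eact s^-1 r^-1 e) (+) (a e && ~~ carried (s @: p.1.2) e)]).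

Lemma eq_bact a b s r : a =1 b -> bact a s r =1 bact b s r.
Proof. by move=> ab p; congr pair; apply/ffunP => e; rewrite !ffunE ab. Qed.

Lemma bactM a b s t r r' p :
  bact b t r' (bact a s r p) =
  bact (fun e => b e (+) a (eact t^-1 r'^-1 e)) (s * t) (r * r') p.
Proof.
case: p => [[w C] x]; rewrite /bact /=.
have E : t @: (s @: C) = (s * t) @: C by rewrite imset_permM.
rewrite permM E; congr pair; apply/ffunP => e; rewrite !ffunE eactM !invMg.
have -> : carried (s @: C) (eact t^-1 r'^-1 e) = carried ((s * t) @: C) e.
  by rewrite -E -{2}[e](eactKV t r') carried_act.
by case: (carried _ _); rewrite ?andbF ?andbT ?addbF // -addbA [_ (+) b e]addbC.
Qed.

Lemma bact1 p : bact (fun=> false) 1 1 p = p.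
Proof.
case: p => [[w C] x]; rewrite /bact /= perm1.
rewrite imset_perm1.
by congr pair; apply/ffunP => e; rewrite !ffunE !invg1 eact1 addbF.
Qed.

Lemma bact_inj a s r : injective (bact a s r).
Proof.
apply: (@can_inj _ _ _ (bact (a \o eact s r) s^-1 r^-1)) => p.
rewrite bactM !mulgV -[RHS]bact1; apply: eq_bact => e.
by rewrite /= !invgK addbb.
Qed.

Definition bperm a s r : {perm bpt} := perm (@bact_inj a s r).

Lemma bpermM a b s t r r' : bperm a s r * bperm b t r' =
  bperm (fun e => b e (+) a (eact t^-1 r'^-1 e)) (s * t) (r * r').
Proof. by apply/permP => p; rewrite permM !permE bactM. Qed.

Lemma eq_bperm a b s r : a =1 b -> bperm a s r = bperm b s r.
Proof. by move=> ab; apply/permP => p; rewrite !permE; apply: eq_bact. Qed.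

(** A potential [phi] on the nodes with its coboundary, distributed over the two half-edges of each
    move. Testing a chain against such pairs expresses its boundary without a boundary map. *)
Definition compat (phi : {perm V} -> O -> bool) (d : edge -> bool) :=
  forall s0 o X s o', piso (dec o') (dec o) X s ->
    d ((s0, o), s @: X) (+) d ((s * s0, o'), X) = phi s0 o (+) phi (s * s0) o'.

(** Relabelling preserves partial isomorphisms, so a symmetry translates moves to moves; this lets
    chains be translated when symmetries are composed. *)
Lemma compat_shift phi d t g : pg_set Gam g -> compat phi d ->
  compat (fun s o => phi (s * t) (lab g o)) (d \o eact t (lab g)).
Proof.
move=> gG c s0 o X s o' p; rewrite /eact /= -mulgA.
by apply: c; rewrite !labE //; apply: piso_relabel.
Qed.

(* Modulo 2, [a] is a chain with boundary [1 - (s, g)] in the graph that joins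
   two nodes when a partial automorphism of A carries one to the other. *)
Definition chain (a : edge -> bool) s g :=
  forall phi d, compat phi d ->
    \big[addb/false]_e (a e && d e) = phi 1 o0 (+) phi s (lab g o0).

Definition bsym g (h : {perm bpt}) :=
  pg_set Gam g /\ exists a s, chain a s g /\ h = bperm a s (lab g).

Lemma bsymG g h : bsym g h -> pg_set Gam g. Proof. by case. Qed.

Lemma bsym1 : bsym (lperm1 L) 1.
Proof.
split; first exact: pg1.
exists (fun=> false), 1; split.
  by move=> phi d _; rewrite lab1 perm1 addbb big1.
by apply/permP => p; rewrite lab1 perm1 permE bact1.
Qed.

Lemma bsymM g1 g2 h1 h2 : bsym g1 h1 -> bsym g2 h2 ->
  bsym (lpermM g2 g1) (h1 * h2).
Proof.
move=> [G1 [a [s [ca ->]]]] [G2 [b [t [cb ->]]]].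
split; first exact: pgM.
(* The chain of the first symmetry is translated by the second one, so that the two boundaries
   telescope at the node (t, g2). *)
exists (fun e => b e (+) a (eact t^-1 (lab g2)^-1 e)), (s * t); split.
  move=> phi d c.
  under eq_bigr do rewrite andb_addl.
  rewrite big_split /= (cb _ _ c) (reindex_inj (can_inj (eactK t (lab g2)))) /=.
  under eq_bigr do rewrite eactK.
  rewrite (ca _ _ (compat_shift t G2 c)) mul1g labM // permM.
  by case: (phi 1 o0); case: (phi t _); case: (phi _ _).
by rewrite bpermM labM.
Qed.

Lemma bsymV g h : bsym g h -> bsym (lpermV g) h^-1.
Proof.
move=> [G [a [s [ca ->]]]]; have GV := pgV G.
split=> //; exists (a \o eact s (lab g)), s^-1; split.
  move=> phi d c.
  rewrite (reindex_inj (can_inj (eactKV s (lab g)))) /=.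
  under eq_bigr do rewrite eactKV.
  have := ca _ _ (compat_shift s^-1 GV c).
  rewrite labV // mul1g mulgV permK => ->.
  by rewrite addbC.
apply/eqP; rewrite eq_invg_mul bpermM labV // !mulgV; apply/eqP/permP => p.
rewrite permE perm1 -[RHS]bact1; apply: eq_bact => e.
by rewrite /= !invgK addbb.
Qed.

Definition bchart (v : V) : bpt := ((v, cl A v), [ffun=> false]).

Lemma bchart_inj : injective bchart.
Proof. by move=> x y []. Qed.

(** The chain is tested against the potential asking at (s0, o) whether s followed by the inverse of
    s0 is a partial isomorphism from [relabel g A] to [dec o] on X. Moves carrying s(X) do not
    change it, so [d] can be 0 on their half-edges, and the potential agrees at both ends of the
    chain. At the end (s, g) it asks about the identity, hence is true; at the other end it is the
    claim. *)
Lemma chain_piso a s g X : pg_set Gam g -> chain a s g -> funclosed A X ->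
  (forall e, a e -> carried (s @: X) e) -> piso (relabel g A) A X s.
Proof.
move=> gG ca cX sa.
pose eta := relabel g A.
have cXe : funclosed eta X by rewrite -funclosed_relabel.
pose phi (s0 : {perm V}) o := `[< piso eta (dec o) X (s * s0^-1) >].
pose d e := phi e.1.1 e.1.2 && ~~ carried (s @: X) e.
have cpt : compat phi d.
  move=> s0 o Y t o' p; rewrite /d /=.
  have -> : carried (s @: X) ((t * s0, o'), Y) =
            carried (s @: X) ((s0, o), t @: Y).
    by rewrite /carried /= imset_permM.
  have [cr|_] := boolP (carried _ _); last by rewrite !andbT.
  rewrite /= !andbF.
  suff -> : phi s0 o = phi (t * s0) o' by rewrite !addbb.
  have sub : (s * s0^-1) @: X \subset t @: Y.
    apply/subsetP => _ /imsetP[x xX ->]; rewrite permM.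
    have /imsetP[y yY ->] := subsetP cr _ (imset_f s xX).
    by rewrite permK.
  have eqt : s * (t * s0)^-1 =1 t^-1%g \o (s * s0^-1)%g.
    by move=> x; rewrite /= invMg mulgA [LHS]permM.
  apply/asboolP/asboolP => h.
    apply: (@eq_piso _ _ _ _ _ (t^-1%g \o (s * s0^-1)%g)).
      by move=> x _; rewrite -eqt.
    apply: (piso_comp h); apply: piso_sub sub (piso_im_closed h) _.
    exact: piso_inv.
  have eq2 : s * s0^-1 =1 t \o (s * (t * s0)^-1)%g.
    by move=> x; rewrite /= eqt /= permKV.
  apply: (@eq_piso _ _ _ _ _ (t \o (s * (t * s0)^-1)%g)).
    by move=> x _; rewrite -eq2.
  apply: (piso_comp h); apply: piso_sub (piso_im_closed h) p.
  apply/subsetP => _ /imsetP[x xX ->]; rewrite eqt /=.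
  have /imsetP[y yY ->] := subsetP sub _ (imset_f (s * s0^-1) xX).
  by rewrite permK.
have := ca _ _ cpt; rewrite big1; last first.
  move=> e _; rewrite /d; case ae: (a e) => //=.
  by rewrite sa // andbF.
have -> : phi s (lab g o0).
  apply/asboolP; rewrite labE // dec0; apply: eq_piso (piso_id cXe) => x _.
  by rewrite mulgV perm1.
rewrite addbT => /esym/negbT; rewrite negbK => /asboolP.
rewrite dec0; apply: eq_piso => x _.
by rewrite invg1 mulg1.
Qed.

(** By [XP], x returns to the chart exactly when s respects its closure and all half-edges of the
    chain carry it. By [chain_piso] on [cl x] this passes to all points of [cl x]. So X is closed,
    and [chain_piso] applies to X itself. *)
Lemma bsym_pa g h : bsym g h ->
  let X := [set x | [exists y, h (bchart x) == bchart y]] in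
  exists2 q, pa Gam A g X q & {in X, forall x, h (bchart x) = bchart (q x)}.
Proof.
move=> [gG [a [s [ca ->]]]] X.
have XP x : reflect (s @: cl A x = cl A (s x) /\
    forall e, a e -> carried (s @: cl A x) e) (x \in X).
  rewrite inE; apply: (iffP existsP) => [[y /eqP]|[ecl acl]].
    rewrite permE /bact /= => -[<- -> /ffunP e0]; split=> // e ae.
    by have := e0 e; rewrite !ffunE ae /= => /negbFE.
  exists (s x); rewrite permE /bact /= ecl; apply/eqP; congr pair.
  apply/ffunP => e; rewrite !ffunE /= -ecl.
  by case ae: (a e) => //=; rewrite acl.
have Xq x : x \in X -> bperm a s (lab g) (bchart x) = bchart (s x).
  move=> /XP[ecl acl]; rewrite permE /bact /= ecl; congr pair.
  apply/ffunP => e; rewrite !ffunE /= -ecl.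
  by case ae: (a e) => //=; rewrite acl.
have clX x : x \in X -> cl A x \subset X.
  move=> /XP[ecl acl]; have p := chain_piso gG ca (@cl_closed _ _ A x) acl.
  apply/subsetP => u ux; apply/XP; split; first exact: (piso_cl ux p).
  move=> e /acl; apply: subset_trans; apply: imsetS; exact: cl_trans.
have cX : funclosed A X by apply: funclosedP.
exists s => //; split=> //; apply: chain_piso ca cX _ => // e ae.
apply/subsetP => _ /imsetP[x xX ->]; have /XP[_ acl] := xX.
by apply: (subsetP (acl _ ae)); apply/imset_f/cl_self.
Qed.

(** The chain of a single move, given by its two half-edges; the exclusive or makes them cancel
    should they coincide. *)
Definition bchain X s g e :=
  (e == ((1, o0), s @: X)) (+) (e == ((s, lab g o0), X)).

Definition bhat X s g := bperm (bchain X s g) s (lab g).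

Lemma bhat_sym g X s : pa Gam A g X s -> bsym g (bhat X s g).
Proof.
move=> [gG p]; split=> //; exists (bchain X s g), s; split=> // phi d c.
under eq_bigr do rewrite andb_addl.
rewrite big_split /= (bigD1 ((1, o0), s @: X)) //= eqxx /=.
rewrite big1; last by move=> e /negbTE ->.
rewrite (bigD1 ((s, lab g o0), X)) //= eqxx /= big1; last by move=> e /negbTE ->.
rewrite !addbF.
have := c 1 o0 X s (lab g o0); rewrite mulg1; apply.
by rewrite labE // dec0.
Qed.

Lemma bhatE g X s : pa Gam A g X s ->
  {in X, forall x, bhat X s g (bchart x) = bchart (s x)}.
Proof.
move=> p x xX; have [gG p'] := p; have ecl := piso_cl xX p'.
have sX := cl_sub (pa_closed p) xX.
rewrite permE /bact /= ecl; congr pair; apply/ffunP => e; rewrite !ffunE /= -ecl.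
rewrite /bchain; have [->|_] := eqVneq e ((s, lab g o0), X).
  by rewrite /carried /= imsetS // andbF.
have [->|_] := eqVneq e ((1, o0), s @: X); last by [].
by rewrite /carried /= imset_perm1 imsetS // andbF.
Qed.

(** After translation, the two moves share the half-edge at the intermediate node (s2, g2) with the
    set s1(X), and this cancels modulo 2. What remains are the half-edges of the composite move. *)
Lemma bhatM g1 g2 X s1 s2 : pa Gam A g1 X s1 -> pa Gam A g2 (s1 @: X) s2 ->
  bhat X (s1 * s2) (lpermM g2 g1) = bhat X s1 g1 * bhat (s1 @: X) s2 g2.
Proof.
move=> [G1 _] [G2 _]; rewrite /bhat bpermM labM //; apply: eq_bperm => e.
rewrite /bchain.
have tr e' : (eact s2^-1 (lab g2)^-1 e == e') = (e == eact s2 (lab g2) e').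
  by apply/eqP/eqP => [<-|->]; rewrite ?eactKV ?eactK.
rewrite !tr /eact /= mul1g labM // permM.
by rewrite imset_permM -addbA; congr (_ (+) _); rewrite addbA addbb addFb.
Qed.

Definition base_system : system Gam A :=
  System bsymG bsym1 bsymM bsymV bchart_inj bsym_pa bhat_sym bhatE bhatM.

End BaseSystem.

(** * Refining a cover by colours *)

Section ColourCover.
Variables (L : language) (Gam : perm_group L) (V : finType) (A : lstruct L V).
Hypothesis L_unary : forall n, funsym L n -> n = 1.
Variables (S : system Gam A) (z : nat).
Local Open Scope group_scope.

Let colours := 'I_z.+1.
Let rels := {set S * S}.
Implicit Types (h k : {perm S}) (r : rels) (X : {set V}) (v u : V).
Local Notation ch := (@chart _ _ _ _ S).

(** The points x with (x, x) in [r] are those that get a colour. Only within a single copy is [r]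
    required to be the kernel of a colouring; it need not be transitive across copies. *)
Definition colourable r := forall g h, sym g h -> exists c : V -> colours,
  forall v v', (h (ch v), h (ch v)) \in r -> (h (ch v'), h (ch v')) \in r ->
  (c v == c v') = ((h (ch v), h (ch v')) \in r).

Definition rmap h r : rels := [set p | (h^-1 p.1, h^-1 p.2) \in r].

Lemma mem_rmap h r x y : ((h x, h y) \in rmap h r) = ((x, y) \in r).
Proof. by rewrite inE /= !permK. Qed.

Lemma rmapM h k r : rmap k (rmap h r) = rmap (h * k) r.
Proof. by apply/setP => p; rewrite !inE /= invMg !permM. Qed.

Lemma rmap1 r : rmap 1 r = r.
Proof. by apply/setP => -[x y]; rewrite inE /= invg1 !perm1. Qed.

Lemma rmapK h : cancel (rmap h) (rmap h^-1).
Proof. by move=> r; rewrite rmapM mulgV rmap1. Qed.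

Lemma rmapVK h : cancel (rmap h^-1) (rmap h).
Proof. by move=> r; rewrite rmapM mulVg rmap1. Qed.

Lemma colourable_rmap g h r : sym g h -> colourable r -> colourable (rmap h r).
Proof.
move=> sh cr g' h' sh'; have [c cE] := cr _ _ (symM sh' (symV sh)).
exists c => v v'; rewrite !inE /= -!permM; exact: cE.
Qed.

Lemma colourable_rmapE g h r : sym g h ->
  `[< colourable (rmap h r) >] = `[< colourable r >].
Proof.
move=> sh; apply/asboolP/asboolP; last exact: colourable_rmap sh.
by move=> /(colourable_rmap (symV sh)); rewrite rmapK.
Qed.

Lemma colour_ex r : exists c : V -> colours, colourable r ->
  forall v v', (ch v, ch v) \in r -> (ch v', ch v') \in r ->
  (c v == c v') = ((ch v, ch v') \in r).
Proof.
have [cr|ncr] := pselect (colourable r); last by exists (fun=> ord0) => /ncr.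
have [c cE] := cr _ _ (sym1 S); exists c => _ v v'.
by have := cE v v'; rewrite !perm1.
Qed.

Definition colour r := sval (cid (colour_ex r)).

Lemma colourE r v v' : colourable r -> (ch v, ch v) \in r ->
  (ch v', ch v') \in r -> (colour r v == colour r v') = ((ch v, ch v') \in r).
Proof. by move=> cr; rewrite /colour; case: cid => c /= /(_ cr); apply. Qed.

Let cpt := (S * {ffun S * rels -> option colours})%type.

Definition admissible x r := `[< colourable r >] && ((x, x) \in r).

Lemma admissible_rmap g h x r : sym g h ->
  admissible (h x) (rmap h r) = admissible x r.
Proof. by move=> sh; rewrite /admissible (colourable_rmapE r sh) mem_rmap. Qed.

(* A point records the colours of its whole closure, so that fixing it fixes
   its closure. *)
Definition cchart v : cpt := (ch v,
  [ffun xr => if [pick u in cl A v | ch u == xr.1] is Some u then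
     if admissible xr.1 xr.2 then Some (colour xr.2 u) else None else None]).

Lemma cchart_in v u r : u \in cl A v -> (cchart v).2 (ch u, r) =
  if admissible (ch u) r then Some (colour r u) else None.
Proof.
move=> uv; rewrite ffunE /=; case: pickP => [u' /andP[_ /eqP/chart_inj->]//|].
by move=> /(_ u); rewrite uv eqxx.
Qed.

Lemma cchart_out v x r : x \notin ch @: cl A v -> (cchart v).2 (x, r) = None.
Proof.
move=> xv; rewrite ffunE /=; case: pickP => // u /andP[uv /eqP e].
by case/negP: xv; rewrite -e imset_f.
Qed.

Lemma cchart_inj : injective cchart.
Proof. by move=> v v' [/chart_inj]. Qed.

Definition cact h (t : rels -> {perm colours}) (p : cpt) : cpt :=
  (h p.1, [ffun xr => omap (t (rmap h^-1 xr.2)) (p.2 (h^-1 xr.1, rmap h^-1 xr.2))]).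

Lemma cactE h t p x r : (cact h t p).2 (h x, rmap h r) = omap (t r) (p.2 (x, r)).
Proof. by rewrite ffunE /= permK rmapK. Qed.

Lemma cptP h (p q : cpt) : p.1 = q.1 ->
  (forall x r, p.2 (h x, rmap h r) = q.2 (h x, rmap h r)) -> p = q.
Proof.
case: p q => [x c] [x' c'] /= -> e; congr pair; apply/ffunP => -[y r].
by have := e (h^-1 y) (rmap h^-1 r); rewrite permKV rmapVK.
Qed.

Lemma cactM h k t t' p : cact k t' (cact h t p) =
  cact (h * k) (fun r => t r * t' (rmap h r)) p.
Proof.
apply: (@cptP (h * k)) => [|x r]; first by rewrite /= permM.
rewrite cactE permM -rmapM !cactE.
by case: (p.2 _) => //= c; rewrite permM.
Qed.

Lemma cact1 p : cact 1 (fun=> 1) p = p.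
Proof.
apply: (@cptP 1) => [|x r]; first by rewrite /= perm1.
by rewrite cactE perm1 rmap1; case: (p.2 _) => //= c; rewrite perm1.
Qed.

Lemma cact_inj h t : injective (cact h t).
Proof.
apply: (@can_inj _ _ _ (cact h^-1 (fun r => (t (rmap h^-1 r))^-1))) => p.
rewrite cactM mulgV -[RHS]cact1; congr (cact _ _ p).
by apply: funext => r; rewrite rmapK mulgV.
Qed.

Definition cperm h t : {perm cpt} := perm (@cact_inj h t).

Lemma cpermM h k t t' :
  cperm h t * cperm k t' = cperm (h * k) (fun r => t r * t' (rmap h r)).
Proof. by apply/permP => p; rewrite permM !permE cactM. Qed.

Lemma cperm1 : cperm 1 (fun=> 1) = 1.
Proof. by apply/permP => p; rewrite permE perm1 cact1. Qed.

(** The colours may be renamed arbitrarily and independently for each relation; [lift_copied] builds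
    the copies it needs from this freedom. *)
Definition csym g (f : {perm cpt}) := exists h t, sym g h /\ f = cperm h t.

Lemma csymG g f : csym g f -> pg_set Gam g.
Proof. by case=> h [t [/symG]]. Qed.

Lemma csym1 : csym (lperm1 L) 1.
Proof. by exists 1, (fun=> 1); split; [exact: sym1|rewrite cperm1]. Qed.

Lemma csymM g1 g2 f1 f2 : csym g1 f1 -> csym g2 f2 ->
  csym (lpermM g2 g1) (f1 * f2).
Proof.
move=> [h [t [sh ->]]] [k [t' [sk ->]]].
exists (h * k), (fun r => t r * t' (rmap h r)); split; first exact: symM.
exact: cpermM.
Qed.

Lemma csymV g f : csym g f -> csym (lpermV g) f^-1.
Proof.
move=> [h [t [sh ->]]].
exists h^-1, (fun r => (t (rmap h^-1 r))^-1); split; first exact: symV.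
apply/eqP; rewrite eq_invg_mul cpermM mulgV -cperm1; apply/eqP; congr cperm.
by apply: funext => r; rewrite rmapK mulgV.
Qed.

(** Off the closure of the point both sides record [None], and on it they record the chosen
    colourings, so only those remain to be compared. *)
Lemma cact_chart g h t X q v : sym g h -> pa Gam A g X q ->
  {in X, forall x, h (ch x) = ch (q x)} -> v \in X ->
  cperm h t (cchart v) = cchart (q v) <->
  forall u r, u \in cl A v -> admissible (ch u) r ->
    t r (colour r u) = colour (rmap h r) (q u).
Proof.
move=> sh p hq vX; have [_ p'] := p.
have clX := subsetP (cl_sub (pa_closed p) vX).
have ecl := piso_cl vX p'.
have inq u : u \in cl A v -> q u \in cl A (q v).
  by move=> uv; rewrite -ecl imset_f.
rewrite permE; split=> [e u r uv ad|e].
  have := congr1 (fun p : cpt => p.2 (h (ch u), rmap h r)) e.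
  rewrite cactE cchart_in // ad /= hq ?clX // cchart_in ?inq //.
  by rewrite -hq ?clX // (admissible_rmap _ _ sh) ad => -[].
apply: (@cptP h) => [|x r]; first exact: hq.
rewrite cactE; have [/imsetP[u uv ->]|xv] := boolP (x \in ch @: cl A v).
  rewrite hq ?clX // !cchart_in ?inq //.
  rewrite -hq ?clX // (admissible_rmap _ _ sh); case: ifP => //= ad.
  by rewrite e.
rewrite !cchart_out //; apply: contra xv => /imsetP[u].
rewrite -ecl => /imsetP[u' u'v ->]; rewrite -hq ?clX // => /perm_inj ->.
exact: imset_f.
Qed.

Lemma csym_pa g f : csym g f ->
  let X := [set x | [exists y, f (cchart x) == cchart y]] in
  exists2 q, pa Gam A g X q & {in X, forall x, f (cchart x) = cchart (q x)}.
Proof.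
move=> [h [t [sh ->]]] X; have /= := sym_pa sh.
set Y := [set x | _] => -[q p hq].
have XY x : x \in X -> x \in Y /\ cperm h t (cchart x) = cchart (q x).
  rewrite inE => /existsP[y /eqP e].
  have e1 : h (ch x) = ch y by have := congr1 fst e; rewrite permE.
  have xY : x \in Y by rewrite inE; apply/existsP; exists y; apply/eqP.
  by split=> //; rewrite e; congr cchart; apply: (@chart_inj _ _ _ _ S);
    rewrite -hq.
have clX x : x \in X -> cl A x \subset X.
  move=> /XY[xY /(cact_chart _ sh p hq xY) e]; apply/subsetP => u ux.
  have uY := subsetP (cl_sub (pa_closed p) xY) _ ux.
  rewrite inE; apply/existsP; exists (q u); apply/eqP.
  apply/(cact_chart _ sh p hq uY) => w r wu; apply: e.
  exact: subsetP (cl_trans ux) _ wu.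
exists q; last by move=> x /XY[].
apply: pa_sub (funclosedP L_unary clX) p.
by apply/subsetP => x /XY[].
Qed.

Definition support X r := [set u in X | (ch u, ch u) \in r].

Definition recolour h X (s : {perm V}) r : {perm colours} :=
  if `[< colourable r >] then
    colmatch (support X r) (colour r) (colour (rmap h r) \o s) else 1.

(** On X, s transports [r] to [rmap h r], and each chosen colouring has its relation as kernel. So s
    determines how the colours must be renamed, and [colmatch] applies. *)
Lemma recolour_kernel g h X (s : {perm V}) r : sym g h ->
  {in X, forall x, h (ch x) = ch (s x)} -> colourable r ->
  same_kernel (support X r) (colour r) (colour (rmap h r) \o s).
Proof.
move=> sh hs cr u v; rewrite !inE => /andP[uX ur] /andP[vX vr] /=.
rewrite !colourE //; last by rewrite -hs // mem_rmap.
- by rewrite -!hs // mem_rmap.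
- exact: colourable_rmap sh cr.
- by rewrite -hs // mem_rmap.
Qed.

Lemma support_imset h X (s : {perm V}) r :
  {in X, forall x, h (ch x) = ch (s x)} ->
  support (s @: X) (rmap h r) = s @: support X r.
Proof.
move=> hs; apply/setP => v; rewrite inE; apply/andP/imsetP.
  move=> [/imsetP[u uX ->]]; rewrite -hs // mem_rmap => ur.
  by exists u => //; rewrite inE uX.
move=> [u]; rewrite inE => /andP[uX ur] ->.
by rewrite -hs // mem_rmap ur imset_f.
Qed.

Definition chat X s g := cperm (hat S X s g) (recolour (hat S X s g) X s).

Lemma chat_sym g X (s : {perm V}) : pa Gam A g X s -> csym g (chat X s g).
Proof. by move=> p; do 2![eexists]; split=> //; apply: hat_sym. Qed.

Lemma chatE g X (s : {perm V}) : pa Gam A g X s ->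
  {in X, forall x, chat X s g (cchart x) = cchart (s x)}.
Proof.
move=> p x xX; have sh := hat_sym S p; have hs := hatE S p.
apply/(cact_chart _ sh p hs xX) => u r ux /andP[cr ur].
have us : u \in support X r.
  by rewrite inE ur (subsetP (cl_sub (pa_closed p) xX)).
rewrite /recolour cr; move/asboolP: cr => cr.
by rewrite colmatchE //; apply: recolour_kernel sh hs cr.
Qed.

Lemma chatM g1 g2 X (s1 s2 : {perm V}) :
  pa Gam A g1 X s1 -> pa Gam A g2 (s1 @: X) s2 ->
  chat X (s1 * s2) (lpermM g2 g1) = chat X s1 g1 * chat (s1 @: X) s2 g2.
Proof.
move=> p1 p2; rewrite /chat cpermM (hatM S p1 p2); congr cperm.
apply: funext => r; rewrite /recolour.
have sh1 := hat_sym S p1; have hs1 := hatE S p1.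
have sh2 := hat_sym S p2; have hs2 := hatE S p2.
rewrite (colourable_rmapE _ sh1); case: asboolP => cr; last by rewrite mulg1.
set h1 := hat S X s1 g1 in sh1 hs1 *; set h2 := hat S _ s2 g2 in sh2 hs2 *.
have ker1 := recolour_kernel sh1 hs1 cr.
have ker2 := recolour_kernel sh2 hs2 (colourable_rmap sh1 cr).
rewrite support_imset // in ker2 *.
rewrite colmatch_imset // -colmatch_comp //.
  by rewrite rmapM; congr colmatch; apply: funext => u /=; rewrite permM.
by move=> u v uK vK; apply: ker2; apply: imset_f.
Qed.

Definition colour_system : system Gam A :=
  System csymG csym1 csymM csymV cchart_inj csym_pa chat_sym chatE chatM.

End ColourCover.

(** * Adjacency and copies *)

Section Copies.
Variables (L : language) (Gam : perm_group L) (V : finType) (A : lstruct L V).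
Local Open Scope group_scope.

Definition adj (S : system Gam A) (x y : S) := exists g h v v',
  [/\ sym g h, x = h (chart S v) & y = h (chart S v')].

Definition copied (S : system Gam A) (C : {set S}) := exists g h,
  sym g h /\ {in C, forall x, exists v, x = h (chart S v)}.

(** Conformality in the sense of hypergraphs, with the copies as hyperedges. Since adjacency of x to
    itself means that x lies in a copy, cliques consist of covered points. *)
Definition conformal (S : system Gam A) :=
  forall C : {set S}, {in C &, forall x y, adj x y} -> copied C.

Lemma adj_sym (S : system Gam A) (x y : S) : adj x y -> adj y x.
Proof. by case=> g [h [v [v' [sh -> ->]]]]; exists g, h, v', v. Qed.

(** Applying h and then the inverse of h' is a symmetry; the chart points that it sends to the chart
    are given by [sym_pa]. *)
Lemma overlap (S : system Gam A) g h g' h' : sym g h -> sym g' h' ->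
  exists X q, pa Gam A (lpermM (lpermV g') g) X q /\
    forall v w, h (chart S v) = h' (chart S w) <-> v \in X /\ w = q v.
Proof.
move=> sh sh'; have /= := sym_pa (symM sh (symV sh')).
set X := [set x | _] => -[q p hq]; exists X, q; split=> // v w; split.
  move=> e; have vX : v \in X.
    rewrite inE; apply/existsP; exists w; rewrite permM e permK.
    by apply/eqP.
  split=> //; apply: (@chart_inj _ _ _ _ S); rewrite -hq // permM e.
  by rewrite permK.
by move=> [vX ->]; rewrite -hq // permM permKV.
Qed.

End Copies.

(** * Copies in a refinement by colours *)

Section ColourCopies.
Variables (L : language) (Gam : perm_group L) (V : finType) (A : lstruct L V).
Hypothesis L_unary : forall n, funsym L n -> n = 1.
Variables (S : system Gam A) (z : nat).
Local Notation S' := (colour_system L_unary S z).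
Local Notation ch := (chart S).
Local Notation rels := {set S * S}.
Implicit Types (p : S') (r : rels).
Local Open Scope group_scope.

Lemma colour_adj p p' : adj p p' -> adj p.1 p'.1.
Proof.
move=> [g [_ [v [v' [[h [t [sh ->]]] -> ->]]]]].
by exists g, h, v, v'; rewrite !permE.
Qed.

Lemma colour_adj_inj p p' : adj p p' -> p.1 = p'.1 -> p = p'.
Proof.
move=> [g [_ [v [v' [[h [t [sh ->]]] -> ->]]]]].
by rewrite !permE /= => /perm_inj/chart_inj ->.
Qed.

(** The colours of a copy over k are read in the coordinates of the copy of h, where copies with
    different projections can be compared. This works because the overlap of the two copies is a
    partial automorphism q of A, and q maps closures to closures. *)
Lemma copy_colour g h g' k t : sym g h -> sym g' k ->
  exists c : rels -> V -> 'I_z.+1, 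
  (forall v w r, k (ch w) = h (ch v) ->
     (forall u, u \in cl A v ->
        (cperm k t (cchart S z w)).2 (h (ch u), rmap h r) =
        if admissible z (ch u) r then Some (c r u) else None) /\
     (forall x, x \notin ch @: cl A v ->
        (cperm k t (cchart S z w)).2 (h x, rmap h r) = None)) /\
  (forall v w v' w' u u' r, k (ch w) = h (ch v) -> k (ch w') = h (ch v') ->
     u \in cl A v -> u' \in cl A v' ->
     admissible z (ch u) r -> admissible z (ch u') r ->
     (c r u == c r u') = ((ch u, ch u') \in r)).
Proof.
move=> sh sk; have [X [q [pq hq]]] := overlap sh sk.
pose m := h * k^-1; have sm : sym _ m := symM sh (symV sk).
have [_ pq'] := pq.
have mk x : h x = k (m x) by rewrite permM permKV.
have rk r : rmap h r = rmap k (rmap m r) by rewrite rmapM mulgKV.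
have mX x : x \in X -> m (ch x) = ch (q x).
  by move=> xX; rewrite permM ((hq x (q x)).2 (conj xX erefl)) permK.
clearbody m.
have vw v w : k (ch w) = h (ch v) -> v \in X /\ w = q v.
  by move/esym/hq.
have clX v : v \in X -> {subset cl A v <= X}.
  by move=> vX; apply/subsetP/cl_sub/vX; apply: pa_closed pq.
exists (fun r u => t (rmap m r) (colour z (rmap m r) (q u))); split.
  move=> v w r /vw[vX ->{w}].
  have ecl := piso_cl vX pq'.
  split=> [u uv|x xv]; rewrite permE rk mk cactE.
    have uX := clX _ vX _ uv.
    rewrite (mX _ uX) cchart_in; last by rewrite -ecl imset_f.
    by rewrite -(mX _ uX) (admissible_rmap _ _ _ sm); case: ifP.
  rewrite cchart_out; first by [].
  apply: contra xv => /imsetP[y]; rewrite -ecl => /imsetP[u uv ->].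
  by rewrite -(mX _ (clX _ vX _ uv)) => /perm_inj ->; apply: imset_f.
move=> v w v' w' u u' r /vw[vX _] /vw[v'X _] uv u'v' /andP[cr ur] /andP[_ u'r].
move/asboolP: cr => cr.
rewrite -(mem_rmap m) in ur; rewrite -(mem_rmap m) in u'r.
rewrite (inj_eq perm_inj) -(mem_rmap m).
rewrite !(mX _ (clX _ vX _ uv)) in ur *.
rewrite !(mX _ (clX _ v'X _ u'v')) in u'r *.
exact: colourE (colourable_rmap sm cr) ur u'r.
Qed.

(** This is how a clique or a path in the refined cover becomes a statement about colours. *)
Lemma adj_colour p p' r : adj p p' -> colourable z r ->
  (p.1, p.1) \in r -> (p'.1, p'.1) \in r ->
  exists c c', [/\ p.2 (p.1, r) = Some c, p'.2 (p'.1, r) = Some c' &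
    (c == c') = ((p.1, p'.1) \in r)].
Proof.
move=> [g [_ [v [v' [[h [t [sh ->]]] -> ->]]]]].
rewrite ![(_ : {perm S'}) _]permE [(cact _ _ _).1]/= [(cact _ _ (cchart _ _ v')).1]/=.
move=> cr; rewrite -[r](rmapVK h) !mem_rmap; set r' := rmap _ r => vr v'r.
have cr' : colourable z r' by apply: colourable_rmap (symV sh) cr.
exists (t r' (colour z r' v)), (t r' (colour z r' v')).
have ad : admissible z (ch v) r' by apply/andP; split=> //; apply/asboolP.
have ad' : admissible z (ch v') r' by apply/andP; split=> //; apply/asboolP.
rewrite !cactE !cchart_in ?cl_self // ad ad'; split=> //.
by rewrite (inj_eq perm_inj) colourE.
Qed.

(** Any two points of C lie in a common copy, so the colours that they record agree where both
    record one, and have kernel r. Together they form a colouring [F r] of the admissible points in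
    the closures below C. Matching the chart colouring with [F r], for each r, gives the colour
    permutations of a copy over h that contains C. *)
Lemma lift_copied (C : {set S'}) : {in C &, forall p p', adj p p'} ->
  copied [set fst p | p in C] -> copied C.
Proof.
move=> aC [g [h [sh hC]]].
have {}hC p : p \in C -> exists v, p.1 = h (ch v).
  by move=> pC; apply: hC; apply: imset_f.
have pair p p' v v' u u' r : p \in C -> p' \in C -> p.1 = h (ch v) ->
    p'.1 = h (ch v') -> u \in cl A v -> u' \in cl A v' ->
    admissible z (ch u) r -> admissible z (ch u') r ->
  exists c c', [/\ p.2 (h (ch u), rmap h r) = Some c,
    p'.2 (h (ch u'), rmap h r) = Some c' & (c == c') = ((ch u, ch u') \in r)].
  move=> pC p'C + + uv u'v' ad ad'.
  have [g' [_ [w [w' [[k [t [sk ->]]] -> ->]]]]] := aC _ _ pC p'C.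
  have [c [cE ck]] := copy_colour t sh sk.
  rewrite {1}permE /= => e; rewrite {1}permE /= => e'.
  have [/(_ _ uv) E _] := cE _ _ r e; have [/(_ _ u'v') E' _] := cE _ _ r e'.
  exists (c r u), (c r u'); rewrite E E' ad ad'; split=> //.
  exact: ck e e' uv u'v' ad ad'.
pose over p u := [exists v, (p.1 == h (ch v)) && (u \in cl A v)].
pose F r u := if [pick p in C | over p u] is Some p
  then odflt ord0 (p.2 (h (ch u), rmap h r)) else ord0.
have FE p v u r : p \in C -> p.1 = h (ch v) -> u \in cl A v ->
    admissible z (ch u) r -> p.2 (h (ch u), rmap h r) = Some (F r u).
  move=> pC e uv ad; have ov : over p u by apply/existsP; exists v; rewrite e eqxx.
  rewrite /F; case: pickP => [p' /andP[p'C]|/(_ p)].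
    move=> /existsP[v' /andP[/eqP e' uv']].
    have [c [c' [-> -> ]]] := pair _ _ _ _ _ _ _ pC p'C e e' uv uv' ad ad.
    by have /andP[_ ->] := ad => /eqP ->.
  by rewrite pC ov.
pose K r := [set u | [exists p in C, over p u] && admissible z (ch u) r].
have ker r : same_kernel (K r) (colour z r) (F r).
  move=> u u'; rewrite !inE.
  move=> /andP[/existsP[p /andP[pC /existsP[v /andP[/eqP e uv]]]] ad].
  move=> /andP[/existsP[p' /andP[p'C /existsP[v' /andP[/eqP e' uv']]]] ad'].
  have [c [c' []]] := pair _ _ _ _ _ _ _ pC p'C e e' uv uv' ad ad'.
  rewrite (FE _ _ _ _ pC e) // (FE _ _ _ _ p'C e') // => -[->] [->] ->.
  move/andP: ad => [/asboolP cr ur]; move/andP: ad' => [_ ur'].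
  exact: colourE.
exists g, (cperm h (fun r => colmatch (K r) (colour z r) (F r))); split.
  by do 2!eexists; split; [exact: sh|].
move=> p pC; have [v e] := hC p pC; exists v.
rewrite permE; apply: (@cptP _ _ _ _ _ _ h) => [|x r]; first exact: e.
rewrite cactE; have [/imsetP[u uv ->]|xv] := boolP (x \in ch @: cl A v).
  rewrite cchart_in //; case: ifP => [ad|nad] /=.
    rewrite (FE _ _ _ _ pC e) // colmatchE // inE ad andbT.
    by apply/existsP; exists p; rewrite pC; apply/existsP; exists v; rewrite e eqxx.
  have [g' [_ [w [_ [[k [t [sk ->]]] ep _]]]]] := aC _ _ pC pC.
  move: e; rewrite ep permE /= => e.
  have [c [cE _]] := copy_colour t sh sk.
  by have [/(_ _ uv) + _] := cE _ _ r e; rewrite permE nad.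
rewrite cchart_out //=.
have [g' [_ [w [_ [[k [t [sk ->]]] ep _]]]]] := aC _ _ pC pC.
move: e; rewrite ep permE /= => e.
have [c [cE _]] := copy_colour t sh sk.
by have [_ /(_ _ xv)] := cE _ _ r e; rewrite permE.
Qed.

Lemma colour_conformal : conformal S -> conformal S'.
Proof.
move=> cS C aC; apply: lift_copied => //; apply: cS.
move=> _ _ /imsetP[p pC ->] /imsetP[p' p'C ->].
by apply: colour_adj; apply: aC.
Qed.

End ColourCopies.

(** * Conformal covers *)

Section Conformal.
Variables (L : language) (Gam : perm_group L) (V : finType) (A : lstruct L V).
Hypothesis L_unary : forall n, funsym L n -> n = 1.

Definition conformal_upto (S : system Gam A) k :=
  forall C : {set S}, #|C| <= k -> {in C &, forall x y, adj x y} -> copied C.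

Lemma copied0 (S : system Gam A) : copied (finset.set0 : {set S}).
Proof.
exists (lperm1 L), 1%g; split=> [|x]; first exact: sym1.
by rewrite finset.in_set0.
Qed.

Lemma conformal_upto2 (S : system Gam A) : conformal_upto S 2.
Proof.
move=> C C2 aC; have [->|[x xC]] := set_0Vmem C; first exact: copied0.
have [C1|[y]] := set_0Vmem (C :\ x).
  have [g [h [v [_ [sh e _]]]]] := aC x x xC xC.
  exists g, h; split=> // y yC; exists v; rewrite -e.
  apply/eqP/negPn; apply: (contraTN _ yC) => yx.
  by have := finset.in_set0 y; rewrite -C1 !inE yx /= => ->.
rewrite !inE => /andP[yx yC].
have [g [h [v [v' [sh ex ey]]]]] := aC x y xC yC.
have CE : C = [set x; y].
  apply/esym/eqP; rewrite eqEcard cards2 eq_sym yx C2 andbT.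
  by apply/subsetP => w; rewrite !inE => /orP[]/eqP->.
exists g, h; split=> // w; rewrite CE !inE => /orP[]/eqP->; [by exists v|by exists v'].
Qed.

Lemma copied_card (S : system Gam A) (C : {set S}) : copied C -> #|C| <= #|V|.
Proof.
move=> [g [h [sh hC]]].
have sub : C \subset [set h (chart S v) | v in V].
  by apply/subsetP => x /hC[v ->]; apply: imset_f.
by apply: leq_trans (subset_leq_card sub) _; apply: leq_imset_card.
Qed.

(* A clique of z + 2 points below which is in no copy would need z + 2 colours. *)
Lemma conformal_step (S : system Gam A) z :
  conformal_upto S z.+1 -> conformal_upto (colour_system L_unary S z) z.+2.
Proof.
move=> cS C' C'z aC; apply: lift_copied => //; set C := [set fst p | p in C'].
have aC1 : {in C &, forall x y, adj x y}.
  move=> _ _ /imsetP[p pC ->] /imsetP[p' p'C ->].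
  by apply: colour_adj; apply: aC.
have [Cz|zC] := leqP #|C| z.+1; first exact: cS.
have [//|nC] := pselect (copied C); exfalso.
pose r : {set S * S} := [set p | (p.1 == p.2) && (p.1 \in C)].
have rE x y : ((x, y) \in r) = (x == y) && (x \in C) by rewrite inE.
(* No copy contains all of C, and C has at most z + 2 points; so at most z + 1 of them lie in a
   given copy, and their indices in [enum K] serve as colours. *)
have cr : colourable z r.
  move=> g h sh; pose K := [set v | h (chart S v) \in C].
  have Kz : #|K| <= z.+1.
    have hi : injective (fun v => h (chart S v)).
      by move=> v v' /perm_inj/chart_inj.
    rewrite -ltnS; apply: leq_trans (leq_trans (leq_imset_card fst _) C'z).
    rewrite -(card_imset _ hi); apply: proper_card; rewrite properEneq.
    apply/andP; split; last first.
      by apply/subsetP => _ /imsetP[v + ->]; rewrite inE.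
    apply/eqP => e; apply: nC; exists g, h; split=> // x.
    by rewrite /C -e => /imsetP[v _ ->]; exists v.
  exists (fun v => inord (index v (enum K))) => v v'.
  rewrite !rE !eqxx /= => vC v'C; rewrite vC andbT.
  have idx u : h (chart S u) \in C -> index u (enum K) < z.+1.
    move=> uC; apply: leq_trans Kz; rewrite cardE index_mem mem_enum inE //.
  apply/eqP/eqP => [/(congr1 (@nat_of_ord _))|/perm_inj/chart_inj -> //].
  rewrite !inordK ?idx // => e; congr (h (chart S _)).
  have := congr1 (nth v (enum K)) e.
  by rewrite !nth_index // mem_enum inE.
pose c (p : colour_system L_unary S z) := odflt ord0 (p.2 (p.1, r)).
(* Adjacent points with the same colour have the same projection, hence are equal. This puts C' into
   z + 1 colours, although its projection C has more than z + 1 points. *)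
have c_inj : {in C' &, injective c}.
  move=> p p' pC p'C; have a := aC _ _ pC p'C.
  have pr q : q \in C' -> (q.1, q.1) \in r.
    by move=> qC; rewrite rE eqxx; apply: imset_f.
  have [d [d' [e e' dd]]] := adj_colour a cr (pr _ pC) (pr _ p'C).
  rewrite /c e e' /= => ed; move: dd; rewrite ed eqxx rE => /esym/andP[/eqP + _].
  exact: colour_adj_inj.
have := leq_trans zC (leq_imset_card fst (mem C')).
have := max_card [set c p | p in C']; rewrite (card_in_imset c_inj) card_ord.
by move=> le /leq_trans/(_ le); rewrite ltnn.
Qed.

(** It suffices to treat cliques of at most |V| + 2 points: a larger one would contain a clique of
    exactly that size, which would lie in a copy, but copies have only |V| points. *)
Lemma conformal_ex (S : system Gam A) : exists S' : system Gam A, conformal S'.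
Proof.
have up k : exists S' : system Gam A, conformal_upto S' k.+2.
  elim: k => [|k [S' cS']]; first by exists S; apply: conformal_upto2.
  by exists (colour_system L_unary S' k.+1); apply: conformal_step.
have [S' cS'] := up #|V|; exists S' => C aC.
have [Ck|kC] := leqP #|C| #|V|.+2; first exact: cS'.
pose D := [set x in take #|V|.+2 (enum C)].
have DC : {subset D <= C} by move=> x; rewrite inE => /mem_take; rewrite mem_enum.
have : copied D.
  apply: cS'; last by move=> x y /DC xC /DC; apply: aC.
  by rewrite cardsE (leq_trans (card_size _)) // size_take; case: ltnP.
move=> /copied_card; rewrite cardsE (card_uniqP _) ?take_uniq ?enum_uniq //.
by rewrite size_takel -?cardE ?(ltnW kC) // => /ltnW; rewrite ltnn.
Qed.

End Conformal.

(** * Mapping points of a cover to M *)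

Section Realization.
Variables (L : language) (Gam : perm_group L) (V : finType) (A : lstruct L V).
Hypothesis L_unary : forall n, funsym L n -> n = 1.
Variables (U : Type) (i : V -> U) (MA : lang_perm L -> (U -> U) -> Prop).
Hypothesis MA_comp : forall g1 g2 t1 t2, MA g1 t1 -> MA g2 t2 ->
  MA (lpermM g2 g1) (t2 \o t1).
Hypothesis MA_inv : forall g t, MA g t -> exists2 t', MA (lpermV g) t' & cancel t t'.
Hypothesis MA_ext : forall g X q, pa Gam A g X q ->
  exists2 t, MA g t & {in X, forall x, t (i x) = i (q x)}.
Local Notation ch := (@chart _ _ _ _ _).

(* On the part of D inside a copy, m is the copy of A in M moved by an
   automorphism of M with the label of that copy. *)
Definition realizes (S : system Gam A) (T : finType) (f : T -> S) (D : {set T})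
    (m : T -> U) :=
  forall g h, sym g h -> exists2 t, MA g t &
    forall x v, x \in D -> f x = h (ch v) -> m x = t (i v).

(** The copy of h is placed in M by [t0]. Any other copy overlaps it in a partial automorphism q of
    A, and an extension of q to M followed by [t0] serves for that copy. *)
Lemma realize_copied (S : system Gam A) (T : finType) (f : T -> S) (D : {set T}) :
  (forall x, adj (f x) (f x)) -> copied (f @: D) -> exists m, realizes f D m.
Proof.
move=> cov [g [h [sh hD]]].
(* The partial automorphism induced by h serves only to obtain some automorphism of M with label
   g. *)
have [q0 p0 _] := sym_pa sh; have [t0 M0 _] := MA_ext p0.
have mP x : exists u, x \in D -> forall v, f x = h (ch v) -> u = t0 (i v).
  have [xD|_] := boolP (x \in D); last first.
    by have [_ [_ [v _]]] := cov x; exists (i v).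
  have [|v e] := hD (f x); first exact: imset_f.
  by exists (t0 (i v)) => _ v'; rewrite e => /perm_inj/chart_inj ->.
have [m mE] := choice mP; exists m => g1 h1 sh1.
have [X [q [pq hq]]] := overlap sh1 sh; have [s Ms sE] := MA_ext pq.
exists (t0 \o s); first by have := MA_comp Ms M0; rewrite lpermMVr.
move=> x v xD e; have [|w e'] := hD (f x); first exact: imset_f.
have [vX ew] := (hq v w).1 (etrans (esym e) e').
by rewrite (mE _ xD _ e') /= sE // ew.
Qed.

(** On the intersection, [m1] and [m2] are the same copy moved by [t1] and by [t2], so they agree
    once [m1] is moved by the inverse of [t1] and then by [t2]. No copy meets both differences, so
    each copy is handled by one of the two maps. *)
Lemma realize_glue (S : system Gam A) (T : finType) (f : T -> S)
    (D1 D2 : {set T}) m1 m2 :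
  copied (f @: (D1 :&: D2)) ->
  (forall x y, x \in D1 :\: D2 -> y \in D2 :\: D1 -> ~ adj (f x) (f y)) ->
  realizes f D1 m1 -> realizes f D2 m2 -> exists m, realizes f (D1 :|: D2) m.
Proof.
move=> [g [h [sh hD]]] sep r1 r2.
have [t1 M1 t1E] := r1 _ _ sh; have [t2 M2 t2E] := r2 _ _ sh.
have [t1' M1' t1K] := MA_inv M1.
pose m x := if x \in D2 then m2 x else t2 (t1' (m1 x)).
have mE x : x \in D1 -> m x = t2 (t1' (m1 x)).
  rewrite /m => x1; case: ifP => // x2.
  have [|v e] := hD (f x); first by apply: imset_f; rewrite inE x1.
  by rewrite (t1E _ _ x1 e) t1K (t2E _ _ x2 e).
exists m => g' h' sh'.
have [[x0 [v0 [x0D e0]]]|no] := pselect (exists x v, x \in D1 :\: D2 /\ f x = h' (ch v)).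
  have [t1'' Mt tE] := r1 _ _ sh'.
  exists (t2 \o t1' \o t1'').
    have := MA_comp Mt (MA_comp M1' M2).
    by rewrite lpermMV lperm1M.
  move=> x v xD e; have x1 : x \in D1.
    apply/negPn/negP => nx1; apply: (sep x0 x) => //.
      by move: xD; rewrite !inE (negbTE nx1).
    by exists g', h', v0, v.
  by rewrite mE //= (tE _ _ x1 e).
have [t2'' Mt tE] := r2 _ _ sh'; exists t2'' => // x v xD e.
have x2 : x \in D2.
  apply/negPn/negP => nx2; apply: no; exists x, v; split=> //.
  by move: xD; rewrite !inE (negbTE nx2) orbF.
by rewrite /m x2; apply: tE.
Qed.

(** * Maps whose adjacencies survive a refinement with two colours *)

Section Chordal.
Variable S : system Gam A.
Hypothesis cS : conformal S.
Local Notation S' := (colour_system L_unary S 1).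
Variables (T : finType) (f' : T -> S').
Local Notation f := (fun x => (f' x).1).
Hypothesis cov : forall x, adj (f x) (f x).
Hypothesis adj_up : forall x y, adj (f x) (f y) -> adj (f' x) (f' y).

(* The double cover of S branched at the links between s and B would separate
   s from itself along the cycle a, s', B, s unless s and s' are adjacent. *)
Lemma separator_clique a s s' (B : {set T}) (e : rel T) c0 c1 :
  adj (f a) (f s) -> adj (f a) (f s') -> (forall c, c \in B -> ~ adj (f a) (f c)) ->
  c0 \in B -> adj (f s) (f c0) -> c1 \in B -> adj (f s') (f c1) ->
  (forall x y, e x y -> [/\ x \in B, y \in B & adj (f x) (f y)]) ->
  connect e c0 c1 -> adj (f s) (f s').
Proof.
move=> as1 as2 aB c0B sc0 c1B sc1 eB conn; have [//|nss] := pselect (adj (f s) (f s')).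
exfalso.
pose FB := f @: B; pose P := [set f a; f s; f s'] :|: FB.
have PE w : (w \in P) = [|| w == f a, w == f s, w == f s' | w \in FB].
  by rewrite /P !in_setU !in_set1 -!orbA.
have FBP c : c \in B -> f c \in FB by move=> cB; apply/imsetP; exists c.
have aFB y : y \in FB -> ~ adj (f a) y by move=> /imsetP[c cB ->]; apply: aB.
have sFB : f s \notin FB by apply/negP => /aFB.
have s'FB : f s' \notin FB by apply/negP => /aFB.
have aFBn : f a \notin FB by apply/negP => /aFB/(_ (cov a)).
pose cut x y := (x == f s) && (y \in FB).
pose r : {set S * S} := [set p | [&& p.1 \in P, p.2 \in P, `[< adj p.1 p.2 >],
  ~~ cut p.1 p.2 & ~~ cut p.2 p.1]].
have rE x y : x \in P -> y \in P -> adj x y ->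
    ((x, y) \in r) = ~~ cut x y && ~~ cut y x.
  by move=> xP yP xy; rewrite inE /= xP yP; have -> : `[< adj x y >] by apply/asboolP.
have rP x y : (x, y) \in r -> x \in P by rewrite inE => /andP[].
have cr : colourable 1 r.
  move=> g h sh; pose J := [exists v, h (ch v) == f s].
  (* In a copy through s, the points of B get the colour that s does not have. If such a copy meets
     B, it contains neither a nor s', so no further pair has to be separated. *)
  exists (fun v => if (h (ch v) \in FB) && J then inord 1 else ord0) => v v' /rP xP /rP yP.
  have xy : adj (h (ch v)) (h (ch v')) by exists g, h, v, v'.
  rewrite rE //.
  have Js u : J -> adj (f s) (h (ch u)).
    by move=> /existsP[w /eqP <-]; exists g, h, w, u.
  have colE (b b' : bool) : ((if b then inord 1 else ord0 : 'I_2) ==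
      (if b' then inord 1 else ord0 : 'I_2)) = (b == b').
    by case: b b' => [] []; rewrite ?eqxx // -val_eqE /= inordK.
  rewrite colE /cut.
  have nJ u : ~~ J -> h (ch u) != f s.
    by apply: contraNneq => eq_us; apply/existsP; exists u; rewrite eq_us.
  have {}xP := xP; move: (Js v) (nJ v) (Js v') (nJ v') xP yP xy.
  move: (h (ch v)) (h (ch v')) => x y {v v'} Jx nJx Jy nJy xP yP xy.
  (* In a copy through s, a point of P outside B and different from s can only be a, because s' is
     not adjacent to s. *)
  have fsP w : w \in P -> J -> (J -> adj (f s) w) -> w \notin FB -> w != f s -> w = f a.
    move=> wP j /(_ j) sw nF ns.
    by move: wP; rewrite PE (negbTE nF) (negbTE ns) /= orbF => /orP[/eqP//|/eqP ws]; case: nss; rewrite -ws.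
  have [j|nj] := boolP J; last first.
    by rewrite !andbF eqxx (negbTE (nJx nj)) (negbTE (nJy nj)).
  rewrite !andbT; have [xF|xF] := boolP (x \in FB); have [yF|yF] := boolP (y \in FB).
  - rewrite !andbT eqxx; apply/esym/andP.
    by split; [apply: contraNneq sFB => <-|apply: contraNneq sFB => <-].
  - rewrite andbF andbT /=; apply/esym/negbTE; rewrite negbK.
    apply/negPn/negP => ys; apply: (aFB x xF); rewrite -(fsP y) //.
    exact: adj_sym.
  - rewrite andbF andbT andbT /=; apply/esym/negbTE; rewrite negbK.
    by apply/negPn/negP => xs; apply: (aFB y yF); rewrite -(fsP x).
  - by rewrite !andbF.
pose kap t := (f' t).2 (f t, r).
have link t t' : f t \in P -> f t' \in P -> adj (f t) (f t') ->
    (kap t == kap t') = ~~ cut (f t) (f t') && ~~ cut (f t') (f t).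
  have rr w : f w \in P -> (f w, f w) \in r.
    move=> wP; rewrite rE // andbb; apply/negP => /andP[/eqP -> sF].
    by rewrite sF in sFB.
  move=> tP t'P tt'.
  have [c [c' [kt kt' kk]]] := adj_colour (adj_up tt') cr (rr t tP) (rr t' t'P).
  by rewrite -rE // /kap kt kt' -kk.
have aP : f a \in P by rewrite PE eqxx.
have sP : f s \in P by rewrite PE eqxx orbT.
have s'P : f s' \in P by rewrite PE eqxx !orbT.
have BP c : c \in B -> f c \in P by move=> /FBP cF; rewrite PE cF !orbT.
(* Going around the cycle s, a, s', c1, ..., c0, the lifted colour [kap] never changes, but the
   closing link from c0 to s is cut and demands a change. *)
have kas : kap a = kap s.
  apply/eqP; rewrite link // /cut (negbTE aFBn) (negbTE sFB) !andbF //.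
have kas' : kap a = kap s'.
  apply/eqP; rewrite link // /cut (negbTE aFBn) (negbTE s'FB) !andbF //.
have kB c c' : c \in B -> c' \in B -> adj (f c) (f c') -> kap c = kap c'.
  move=> cB c'B cc'; apply/eqP; rewrite link ?BP // /cut.
  have ns d : d \in B -> (f d == f s) = false.
    by move=> /FBP dF; apply/negbTE; apply: contraNneq sFB => <-.
  by rewrite !ns.
have kc : kap c0 = kap c1.
  case/connectP: conn => w; elim: w c0 c0B {sc0} => [|d w IH] c cB /=; first by move=> _ ->.
  move=> /andP[/eB[_ dB cd] wd] e1; rewrite (kB _ _ cB dB cd); exact: IH.
have ks'c : kap s' = kap c1.
  apply/eqP; rewrite (link _ _ s'P (BP _ c1B) sc1) /cut (negbTE s'FB) andbF andbT.
  by apply/nandP; left; apply: contra_notN nss => /eqP <-.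
have : kap s == kap c0 by rewrite -kas kas' ks'c kc.
by rewrite (link _ _ sP (BP _ c0B) sc0) /cut eqxx FBP.
Qed.

(** As in Dirac's theorem on chordal graphs, the induction splits D at a clique separator. For
    non-adjacent a and b, let B be the component of b among the non-neighbours of a, and N the outer
    neighbours of B. All of N is adjacent to a, since otherwise it would belong to B, and N is a
    clique by [separator_clique]. The realizations of B with N and of D without B are glued along
    N. *)
Lemma realize_chordal (D : {set T}) : exists m, realizes f D m.
Proof.
have [n] := ubnP #|D|; elim: n D => // n IH D Dn.
have [clq|] := pselect ({in D &, forall x y, adj (f x) (f y)}).
  apply: realize_copied => //; apply: cS => _ _ /imsetP[x xD ->] /imsetP[y yD ->].
  exact: clq.
move=> nclq; have [a [b [aD bD nab]]] : exists a b, [/\ a \in D, b \in D & ~ adj (f a) (f b)].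
  apply: contra_notP nclq => no x y xD yD; apply: contra_notP no => nxy.
  by exists x, y.
pose E x y := `[< adj (f x) (f y) >].
have EP x y : reflect (adj (f x) (f y)) (E x y) by apply: asboolP.
have Esym x y : E x y = E y x by apply/EP/EP; apply: adj_sym.
pose Q := [set x in D | ~~ E a x].
pose e x y := [&& E x y, x \in Q & y \in Q].
have bQ : b \in Q by rewrite inE bD; apply/EP.
pose B := [set x | connect e b x].
have BQ x : x \in B -> x \in Q.
  rewrite inE => /connectP[w]; elim/last_ind: w => [_ -> //|w d _].
  by rewrite rcons_path last_rcons => /andP[_ /and3P[_ _ dQ]] ->.
have Bstep x y : x \in B -> y \in Q -> E x y -> y \in B.
  move=> xB yQ xy; have xQ := BQ _ xB; move: xB; rewrite !inE => /connect_trans; apply.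
  by apply: connect1; rewrite /e xy xQ.
pose N := [set s in D | (s \notin B) && [exists c in B, E s c]].
have aN s : s \in N -> adj (f a) (f s).
  rewrite inE => /and3P[sD sB /existsP[c /andP[cB sc]]].
  apply/EP/negPn/negP => nas; case/negP: sB; apply: Bstep cB _ _.
    by rewrite inE sD.
  by rewrite Esym.
have aB c : c \in B -> ~ adj (f a) (f c).
  by move=> /BQ; rewrite inE => /andP[_ /EP].
have Nclq : {in N &, forall s s', adj (f s) (f s')}.
  move=> s s' sN s'N; have as1 := aN _ sN; have as2 := aN _ s'N.
  move: sN s'N; rewrite !inE => /and3P[_ _ /existsP[c /andP[cB /EP sc]]].
  move=> /and3P[_ _ /existsP[c' /andP[c'B /EP s'c']]].
  pose e' x y := e x y && (x \in B).
  apply: (@separator_clique a s s' B e' c c') => //.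
    move=> x y /andP[/and3P[xy xQ yQ] xB]; split=> //; last exact/EP.
    exact: Bstep xB yQ xy.
  have esym : connect_sym e.
    apply: sym_connect_sym => x y.
    by rewrite /e Esym; case: (x \in Q); case: (y \in Q); rewrite ?andbF.
  have : connect e c c'.
    move: cB c'B; rewrite !inE => bc bc'.
    by apply: connect_trans bc'; rewrite esym.
  move=> /connectP[w]; elim: w c cB {sc} => [|d w IHw] x xB /=; first by move=> _ ->.
  move=> /andP[xd wd] lw; have dB : d \in B.
    by have /and3P[xd' _ dQ] := xd; apply: Bstep xB dQ xd'.
  apply: connect_trans (IHw d dB wd lw); apply: connect1.
  by rewrite /e' xd xB.
have BD : B \subset D by apply/subsetP => x /BQ; rewrite inE => /andP[].
have ND : N \subset D by apply/subsetP => x; rewrite inE => /andP[].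
have NB x : x \in N -> x \notin B by rewrite inE => /and3P[].
have bB : b \in B by rewrite inE connect0.
have aa : E a a by apply/EP.
have [|m1 m1E] := IH (B :|: N).
  rewrite -ltnS; apply: leq_trans Dn; rewrite ltnS; apply: proper_card.
  apply/properP; split; first by rewrite subUset BD.
  exists a => //; rewrite inE negb_or; apply/andP; split.
    by apply/negP => /BQ; rewrite inE aa andbF.
  by rewrite inE; apply/negP => /and3P[_ _ /existsP[c /andP[/aB cB /EP]]].
have [|m2 m2E] := IH (D :\: B).
  rewrite -ltnS; apply: leq_trans Dn; rewrite ltnS; apply: proper_card.
  apply/properP; split; first exact: subsetDl.
  by exists b => //; rewrite inE bB.
have [||m mE] := realize_glue _ _ m1E m2E; last first.
- exists m; move: mE; congr realizes; apply/setP => x; rewrite !inE.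
  have [xB|xB] := boolP (connect e b x).
    by have /subsetP->// := BD; rewrite inE.
  rewrite /=; apply/orP/idP => [[/andP[]//|//]|xD]; by right.
- move=> x y; rewrite !in_setD !in_setU negb_or.
  move=> /andP[xnD /orP[xB|xN]]; last first.
    by move: xnD; rewrite (NB _ xN) (subsetP ND).
  move=> /andP[/andP[yB yN] /andP[_ yD]] /adj_sym/EP xy.
  case/negP: yN; rewrite inE yD yB; apply/existsP; exists x.
  by rewrite xB.
apply: cS => _ _ /imsetP[x xN ->] /imsetP[y yN ->].
have sub z : z \in (B :|: N) :&: (D :\: B) -> z \in N.
  by rewrite in_setI in_setU in_setD => /andP[/orP[->|->]].
by apply: Nclq; apply: sub.
Qed.

End Chordal.

(** Maps are graded by their number of non-adjacent pairs, which projection to a lower cover cannot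
    increase; this is the measure of the induction over refinements. *)
Definition realizable (S : system Gam A) n := forall (T : finType) (f : T -> S),
  (forall x, adj (f x) (f x)) ->
  #|[set p : T * T | ~~ `[< adj (f p.1) (f p.2) >]]| <= n ->
  exists m, realizes f [set: T] m.

Lemma realizable0 (S : system Gam A) : conformal S -> realizable S 0.
Proof.
move=> cS T f cov; rewrite leqn0 cards_eq0 => /eqP e0.
apply: realize_copied => //; apply: cS => _ _ /imsetP[x _ ->] /imsetP[y _ ->].
have := finset.in_set0 (x, y); rewrite -e0 inE /= => /negbT.
by rewrite negbK => /asboolP.
Qed.

(* The cover unwinds f unless some non-adjacent pair becomes adjacent below. *)
Lemma realizable_step (S : system Gam A) n : conformal S -> realizable S n ->
  realizable (colour_system L_unary S 1) n.+1.
Proof.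
move=> cS rS T f' cov' le_n; pose f x := (f' x).1.
have cov x : adj (f x) (f x) by apply: colour_adj.
suff [m mE] : exists m, realizes f [set: T] m.
  exists m => g _ [h [t [sh ->]]]; have [t' Mt tE] := mE _ _ sh.
  exists t' => // x v xT e; apply: tE => //.
  by rewrite /f e permE.
have [up|] := pselect (forall x y, adj (f x) (f y) -> adj (f' x) (f' y)).
  exact: (@realize_chordal S cS T f' cov up [set: T]).
move=> nup; apply: rS => //; rewrite -ltnS; apply: leq_trans le_n.
apply: proper_card; apply/properP; split.
  apply/subsetP => -[x y]; rewrite !inE /= => /asboolPn xy; apply/asboolPn.
  by move=> /colour_adj.
have [x [y [xy nxy]]] : exists x y, adj (f x) (f y) /\ ~ adj (f' x) (f' y).
  apply: contra_notP nup => no x y xy; apply: contra_notP no => nxy.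
  by exists x, y.
exists (x, y); rewrite inE /=; first exact/asboolPn.
by rewrite negbK; apply/asboolP.
Qed.

Lemma realizable_ex (S : system Gam A) n : exists S' : system Gam A,
  conformal S' /\ realizable S' n.
Proof.
elim: n => [|n [S' [cS' rS']]].
  have [S' cS'] := conformal_ex L_unary S; exists S'; split=> //.
  exact: realizable0.
exists (colour_system L_unary S' 1); split.
  exact: colour_conformal.
exact: realizable_step.
Qed.
End Realization.

(** * Discarding the points outside all copies *)

Section Restriction.
Variables (L : language) (Gam : perm_group L) (V : finType) (A : lstruct L V).
Variable S : system Gam A.
Local Open Scope group_scope.
Local Notation ch := (chart S).

Lemma adj_chart v : adj (ch v) (ch v).
Proof. by exists (lperm1 L), 1, v, v; rewrite perm1; split=> //; apply: sym1. Qed.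

Lemma adj_act g h x y : sym g h -> adj x y -> @adj _ _ _ _ S (h x) (h y).
Proof.
move=> sh [g' [h' [v [v' [sh' -> ->]]]]].
by exists (lpermM g g'), (h' * h), v, v'; rewrite !permM; split=> //; apply: symM.
Qed.

Let cpt := {x : S | `[< adj x x >]}.

Definition rchart v : cpt := Sub (ch v) (asboolT (adj_chart v)).

(** Symmetries permute the points lying in copies, so for them the default value of [insubd] is
    never taken. *)
Definition rperm (h : {perm S}) : {perm cpt} := injperm (fun x : cpt => insubd x (h (val x))).

Definition rsym g (f : {perm cpt}) := exists h, sym g h /\ forall x, val (f x) = h (val x).

Lemma rpermE g h : sym g h -> forall x, val (rperm h x) = h (val x).
Proof.
move=> sh; have E (x : cpt) : val (insubd x (h (val x))) = h (val x).
  rewrite insubdK //; apply/asboolP; apply: adj_act sh _.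
  by apply/asboolP; exact: (valP x).
by move=> x; rewrite injpermE ?E // => y z /(congr1 val); rewrite !E => /perm_inj/val_inj.
Qed.

Lemma rsymG g f : rsym g f -> pg_set Gam g.
Proof. by case=> h [/symG]. Qed.

Lemma rsym1 : rsym (lperm1 L) 1.
Proof. by exists 1; split=> [|x]; [exact: sym1|rewrite !perm1]. Qed.

Lemma rsymM g1 g2 f1 f2 : rsym g1 f1 -> rsym g2 f2 -> rsym (lpermM g2 g1) (f1 * f2).
Proof.
move=> [h1 [s1 e1]] [h2 [s2 e2]]; exists (h1 * h2); split; first exact: symM.
by move=> x; rewrite !permM e2 e1.
Qed.

Lemma rsymV g f : rsym g f -> rsym (lpermV g) f^-1.
Proof.
move=> [h [s e]]; exists h^-1; split; first exact: symV.
by move=> x; apply: (@perm_inj _ h); rewrite permKV -e permKV.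
Qed.

Lemma rchart_inj : injective rchart.
Proof. by move=> v v' /(congr1 val) /chart_inj. Qed.

Lemma rsym_pa g f : rsym g f ->
  let X := [set x | [exists y, f (rchart x) == rchart y]] in
  exists2 q, pa Gam A g X q & {in X, forall x, f (rchart x) = rchart (q x)}.
Proof.
move=> [h [s e]] /=; have /= := sym_pa s.
set Y := [set x | _]; set X := [set x | _] => -[q p hq].
have -> : X = Y.
  apply/setP => x; rewrite !inE; apply/existsP/existsP => -[y /eqP xy]; exists y.
    by apply/eqP; rewrite -[ch x]/(val (rchart x)) -e xy.
  by apply/eqP/val_inj; rewrite e.
by exists q => // x /hq ex; apply: val_inj; rewrite e.
Qed.

Definition rhat X s g := rperm (hat S X s g).

Lemma rhat_sym g X (s : {perm V}) : pa Gam A g X s -> rsym g (rhat X s g).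
Proof.
move=> /(hat_sym S) sh; exists (hat S X s g); split=> //; exact: rpermE sh.
Qed.

Lemma rhatE g X (s : {perm V}) : pa Gam A g X s ->
  {in X, forall x, rhat X s g (rchart x) = rchart (s x)}.
Proof.
by move=> p x xX; apply: val_inj; rewrite (rpermE (hat_sym S p)) /= (hatE S p).
Qed.

Lemma rhatM g1 g2 X (s1 s2 : {perm V}) :
  pa Gam A g1 X s1 -> pa Gam A g2 (s1 @: X) s2 ->
  rhat X (s1 * s2) (lpermM g2 g1) = rhat X s1 g1 * rhat (s1 @: X) s2 g2.
Proof.
move=> p1 p2; have sh1 := hat_sym S p1; have sh2 := hat_sym S p2.
rewrite /rhat (hatM S p1 p2); apply/permP => x; apply: val_inj.
by rewrite permM (rpermE (symM sh1 sh2)) (rpermE sh2) (rpermE sh1) permM.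
Qed.

Definition restriction : system Gam A :=
  System rsymG rsym1 rsymM rsymV rchart_inj rsym_pa rhat_sym rhatE rhatM.

Lemma adj_val (x y : restriction) : adj x y <-> adj (val x) (val y).
Proof.
split=> [[g [f [v [v' [[h [sh e]] -> ->]]]]]|[g [h [v [v' [sh ex ey]]]]]].
  by rewrite !e; exists g, h, v, v'.
exists g, (rperm h), v, v'; split.
- by exists h; split=> //; exact: rpermE sh.
- by apply: val_inj; rewrite (rpermE sh).
- by apply: val_inj; rewrite (rpermE sh).
Qed.

Lemma adj_restriction (x : restriction) : adj x x.
Proof. by apply/adj_val/asboolP; apply: valP x. Qed.

Lemma restriction_conformal : conformal S -> conformal restriction.
Proof.
move=> cS C aC; have [|g [h [sh hC]]] := cS (val @: C).
  by move=> _ _ /imsetP[x xC ->] /imsetP[y yC ->]; apply/adj_val/aC.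
exists g, (rperm h); split; first by exists h; split=> //; exact: rpermE sh.
move=> x xC; have [|v e] := hC (val x); first exact: imset_f.
by exists v; apply: val_inj; rewrite (rpermE sh).
Qed.

Lemma restriction_realizable (U : Type) (i : V -> U) MA n :
  realizable i MA S n -> realizable i MA restriction n.
Proof.
move=> rS T f cov le_n; have [||m mE] := rS T (fun x => val (f x)).
- by move=> x; apply/adj_val.
- apply: leq_trans le_n; apply: subset_leq_card; apply/subsetP => p.
  by rewrite !inE => /asboolPn np; apply/asboolPn => /adj_val.
exists m => g k [h [sh e]]; have [t Mt tE] := mE _ _ sh; exists t => // x v xT ef.
by apply: tE => //; rewrite ef e.
Qed.

End Restriction.

(** * Embeddings, substructures and irreducibility *)

Section Structures.
Variables (L : language) (Gam : perm_group L).

Lemma embeddingP (V W : Type) (A : lstruct L V) (B : lstruct L W) (f : gmap L V W) :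
  embedding Gam A B f <->
  [/\ pg_set Gam (lpart f), injective (vpart f),
      (forall n (R : relsym L n) x,
         relI A R x <-> relI B (permR (lpart f) R) (vpart f \o x)) &
      (forall n (F : funsym L n) x u,
         funI B (permF (lpart f) F) (vpart f \o x) u <->
         exists2 y, funI A F x y & vpart f y = u)].
Proof.
split=> [[[G h1 h2] fi fr ff]|[G fi fr ff]]; split=> //.
- by move=> n F x u; rewrite -ff.
- by split=> // n R x; [move/fr|move=> u ux; apply/ff].
- move=> n F x; apply/seteqP; split=> u; first by move=> ux; apply/ff.
  by move/ff.
Qed.

Lemma automorphismP (V : Type) (A : lstruct L V) g t :
  automorphism Gam A (GMap g t) <->
  [/\ pg_set Gam g, bijective t,
      (forall n (R : relsym L n) x, relI A R x <-> relI A (permR g R) (t \o x)) &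
      (forall n (F : funsym L n) x y,
         funI A F x y <-> funI A (permF g F) (t \o x) (t y))].
Proof.
split=> [[/embeddingP[G ti tr tf] tb]|[G tb tr tf]].
  split=> // n F x y; rewrite (tf n F x (t y)); split=> [Fy|[y' Fy /ti <- //]].
  by exists y.
have [t' tK t'K] := tb.
split=> //; apply/embeddingP; split=> // [|n F x u]; first exact: can_inj tK.
split=> [Fu|[y + <-]]; last by move/tf.
by exists (t' u) => //; apply/tf; rewrite t'K.
Qed.

Lemma automorphism_comp (V : Type) (A : lstruct L V) g1 g2 t1 t2 :
  automorphism Gam A (GMap g1 t1) -> automorphism Gam A (GMap g2 t2) ->
  automorphism Gam A (GMap (lpermM g2 g1) (t2 \o t1)).
Proof.
move=> /automorphismP[G1 b1 r1 f1] /automorphismP[G2 b2 r2 f2].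
apply/automorphismP; split; [exact: pgM|exact: bij_comp| |].
- by move=> n R x; rewrite r1 r2.
- by move=> n F x y; rewrite f1 f2.
Qed.

Lemma automorphism_inv (V : Type) (A : lstruct L V) g t :
  automorphism Gam A (GMap g t) ->
  exists2 t', automorphism Gam A (GMap (lpermV g) t') & cancel t t'.
Proof.
move=> /automorphismP[G [t' tK t'K] r f]; exists t' => //.
have xK n (x : 'I_n -> V) : t \o (t' \o x) = x by apply: funext => j /=.
apply/automorphismP; split; [exact: pgV|by exists t| |].
- by move=> n R x; rewrite (r _ (permRV g R)) xK permRVK.
- by move=> n F x y; rewrite (f _ (permFV g F)) xK permFVK t'K.
Qed.

Definition funstable (V : Type) (A : lstruct L V) (X : set V) :=
  forall n (F : funsym L n) x y, (forall j, X (x j)) -> funI A F x y -> X y.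

Lemma substructureP (V : Type) (A : lstruct L V) (X : set V) :
  substructure Gam A X <-> funstable A X.
Proof.
split=> [/embeddingP[_ _ _ f] n F x y xX Fy|c].
  pose x' j : X := exist _ (x j) (mem_set (xX j)).
  have [|y' _ <-] := (f n F x' y).1; first exact: Fy.
  exact: set_valP.
apply/embeddingP; split=> //; first exact: pg1.
move=> n F x u; split=> [Fu|[y + <-] //].
have Xu : X u by apply: c Fu => j; apply: set_valP.
by exists (exist _ u (mem_set Xu)).
Qed.

Lemma inclusion2_embedding (V : Type) (A : lstruct L V) (X Y : set V)
    (XY : (X `<=` Y)%classic) : funstable A X ->
  embedding Gam (induced A X) (induced A Y) (inclusion2 L XY).
Proof.
move=> c; apply/embeddingP; split=> //; first exact: pg1.
  by move=> x y /(congr1 val) /= xy; apply: val_inj.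
move=> n F x u; split=> [Fu|[y + <-] //].
have Xu : X (val u) by apply: c Fu => j; exact: (set_valP (x j)).
by exists (exist _ (val u) (mem_set Xu)) => //; apply: val_inj.
Qed.

Lemma range_inclusion (V : Type) (X : set V) : range (vpart (inclusion L X)) = X.
Proof.
apply/seteqP; split=> x; first by move=> [y _ <-]; apply: set_valP.
by move=> Xx; exists (exist _ x (mem_set Xx)).
Qed.

(* If x and y lie in no common K, then C is the free amalgam of the points whose
   closure misses y and of those whose closure misses x. *)
Lemma irreducible_linked (T : Type) (C : lstruct L T) (K : set (set T)) :
  (forall n, funsym L n -> n = 1) -> irreducible Gam C ->
  (forall k, K k -> funstable C k) -> (forall x, exists2 k, K k & k x) ->
  (forall n (R : relsym L n) x, relI C R x -> exists2 k, K k & forall j, k (x j)) ->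
  forall x y, exists k, [/\ K k, k x & k y].
Proof.
move=> un irr Kc Kcov Krel x y; apply: contrapT => nK; apply: irr.
(* [below c d] says that d lies in the closure of c. *)
pose below c d := forall Z, funstable C Z -> Z c -> Z d.
pose X1 : set T := fun c => ~ below c y; pose X2 : set T := fun c => ~ below c x.
have notboth c : below c x -> below c y -> False.
  move=> cx cy; have [k Kk kc] := Kcov c; apply: nK; exists k; split=> //.
    by apply: cx => //; apply: Kc.
  by apply: cy => //; apply: Kc.
have cl d : funstable C (fun c => ~ below c d).
  move=> n F t c; have n1 := un n F; move: F t; rewrite n1 => F t tX Fc cd.
  apply: (tX ord0) => Z cZ Zt; apply: cd => //.
  by apply: cZ Fc => j; rewrite ord1.
have c1 : funstable C X1 := @cl y.
have c2 : funstable C X2 := @cl x.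
have c0 : funstable C (X1 `&` X2)%classic.
  move=> n F t c tX Fc; split; first by apply: c1 Fc => j; have [] := tX j.
  by apply: c2 Fc => j; have [] := tX j.
have X01 : (X1 `&` X2 `<=` X1)%classic by move=> ? [].
have X02 : (X1 `&` X2 `<=` X2)%classic by move=> ? [].
exists (X1 `&` X2)%classic, X1, X2, X01, X02; split.
- by split; apply/substructureP.
- by move=> X1T; have : X1 y by [rewrite X1T]; apply.
- by move=> X2T; have : X2 x by [rewrite X2T]; apply.
split.
- split; last by rewrite !range_inclusion.
  split; first by split; apply: inclusion2_embedding.
  by split=> //; apply/substructureP.
- rewrite !range_inclusion; apply/seteqP; split=> // c _.
  by have [?|?] := pselect (below c y); [right=> ?; apply: (notboth c)|left].
move=> n t [[j [z1 nz1 e1]] [j' [z2 nz2 e2]]].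
have b1 : below (t j) x.
  apply: contrapT => nb; apply: nz1; rewrite -e1 in nb.
  have z0 : (X1 `&` X2)%classic (val z1) by split=> //; apply: set_valP.
  by exists (exist _ (val z1) (mem_set z0)) => //; apply: val_inj.
have b2 : below (t j') y.
  apply: contrapT => nb; apply: nz2; rewrite -e2 in nb.
  have z0 : (X1 `&` X2)%classic (val z2) by split=> //; apply: set_valP.
  by exists (exist _ (val z2) (mem_set z0)) => //; apply: val_inj.
(* A relation holding of [t] would put x and y into one member of K. A unary function has a single
   argument, whose closure cannot contain both x and y by [notboth]. *)
split=> [R /Krel[k Kk kt]|F].
  apply: nK; exists k; split=> //; first by apply: b1 (kt j); apply: Kc.
  by apply: b2 (kt j'); apply: Kc.
have n1 := un n F; move: F t j j' {e1 e2} b1 b2; rewrite n1 => F t j j'.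
by rewrite !ord1 => /notboth h /h.
Qed.

Lemma partial_autP (V : Type) (A : lstruct L V) (X Y : set V) (f : gmap L X Y) :
  partial_aut Gam A f <->
  [/\ pg_set Gam (lpart f), funstable A X /\ funstable A Y, bijective (vpart f),
      (forall n (R : relsym L n) (x : 'I_n -> X),
         relI A R (fun j => val (x j)) <->
         relI A (permR (lpart f) R) (fun j => val (vpart f (x j)))) &
      (forall n (F : funsym L n) (x : 'I_n -> X) (y : X),
         funI A F (fun j => val (x j)) (val y) <->
         funI A (permF (lpart f) F) (fun j => val (vpart f (x j))) (val (vpart f y)))].
Proof.
split=> [[/substructureP cX /substructureP cY [/embeddingP[G fi fr ff] fb]]|].
  split=> // n F x y; split=> [Fy|Fy].
    by apply/(ff n F x (vpart f y)); exists y.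
  by have [y' ? /fi <-] := (ff n F x (vpart f y)).1 Fy.
move=> [G [cX cY] fb fr ff]; have [f' fK f'K] := fb.
split; [exact/substructureP|exact/substructureP|split=> //].
apply/embeddingP; split=> // [|n F x u]; first exact: can_inj fK.
split=> [Fu|[y + <-]]; last by move/ff.
by exists (f' u) => //; apply/ff; rewrite f'K.
Qed.

End Structures.

(** * The structure of a cover *)

Section CoverStructure.
Variables (L : language) (Gam : perm_group L) (V : finType) (A : lstruct L V).
Hypothesis L_unary : forall n, funsym L n -> n = 1.
Variable S : system Gam A.
Local Notation ch := (chart S).

(** The copy of a symmetry with label g carries A relabelled by g, so that symmetries become
    automorphisms with their labels as language parts. *)
Definition cover_struct : lstruct L S := LStruct
  (fun n R w => exists g h x,
    [/\ sym g h, w = (fun j => h (ch (x j))) & relI A (permRV g R) x])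
  (fun n F w u => exists g h x y,
    [/\ sym g h, w = (fun j => h (ch (x j))), u = h (ch y) &
        funI A (permFV g F) x y]).
Local Notation B := cover_struct.

(** A tuple may lie in several copies; they agree on it because their overlap is a partial
    automorphism of A with the quotient of the two labels as language part. *)
Lemma cover_rel g h n (R : relsym L n) (x : 'I_n -> V) : sym g h ->
  relI B R (fun j => h (ch (x j))) <-> relI A (permRV g R) x.
Proof.
move=> sh; split=> [[g1 [h1 [x1 [sh1 e]]]]|Rx]; last by exists g, h, x.
have [X [q [[_ p] hq]]] := overlap sh1 sh.
have xq j : x1 j \in X /\ x j = q (x1 j).
  by apply/hq; have := congr1 (@^~ j) e.
have -> : x = q \o x1 by apply: funext => j; have [_ ->] := xq j.
rewrite -(piso_rel p) /=; last by move=> j; have [] := xq j.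
by rewrite permRVK.
Qed.

(** As for relations; moreover the overlap of two copies is closed under the functions, so values
    computed in another copy lie in this one. *)
Lemma cover_fun g h n (F : funsym L n) (x : 'I_n -> V) u : sym g h ->
  funI B F (fun j => h (ch (x j))) u <->
  exists2 y, funI A (permFV g F) x y & h (ch y) = u.
Proof.
move=> sh; split=> [[g1 [h1 [x1 [y1 [sh1 e -> Fy]]]]]|[y Fy <-]]; last first.
  by exists g, h, x, y.
have [X [q [pq hq]]] := overlap sh1 sh; have [_ p] := pq.
have xq j : x1 j \in X /\ x j = q (x1 j).
  by apply/hq; have := congr1 (@^~ j) e.
have x1X j : x1 j \in X by have [] := xq j.
have -> : x = q \o x1 by apply: funext => j; have [_ ->] := xq j.
have yX : y1 \in X by apply: (pa_closed pq) Fy.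
exists (q y1); last by apply/esym/hq.
by apply: (piso_fun p) => //; rewrite /= permFVK.
Qed.

Lemma chart_rel n (R : relsym L n) (x : 'I_n -> V) :
  relI B R (fun j => ch (x j)) <-> relI A R x.
Proof.
have := cover_rel R x (sym1 S).
by under [in X in relI B _ X]eq_fun do rewrite perm1.
Qed.

Lemma chart_fun n (F : funsym L n) (x : 'I_n -> V) u :
  funI B F (fun j => ch (x j)) u <-> exists2 y, funI A F x y & ch y = u.
Proof.
have := cover_fun F x u (sym1 S).
under [in X in funI B _ X]eq_fun do rewrite perm1.
by move=> ->; split=> -[y Fy <-]; exists y; rewrite ?perm1.
Qed.

Lemma sym_rel g k n (R : relsym L n) w : sym g k ->
  relI B R w -> relI B (permR g R) (k \o w).
Proof.
move=> sk [g' [h [x [sh -> Rx]]]]; exists (lpermM g g'), (h * k)%g, x.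
split; [exact: symM|by apply: funext => j; rewrite /= permM|].
by rewrite /= permRK.
Qed.

Lemma sym_fun g k n (F : funsym L n) w u : sym g k ->
  funI B F w u -> funI B (permF g F) (k \o w) (k u).
Proof.
move=> sk [g' [h [x [y [sh -> -> Fx]]]]]; exists (lpermM g g'), (h * k)%g, x, y.
split; [exact: symM|by apply: funext => j; rewrite /= permM|by rewrite permM|].
by rewrite /= permFK.
Qed.

Lemma sym_automorphism g k : sym g k -> automorphism Gam B (GMap g k).
Proof.
move=> sk; have wK n (w : 'I_n -> S) : (k^-1)%g \o (k \o w) = w.
  by apply: funext => j; rewrite /= permK.
apply/automorphismP; split.
- exact: symG sk.
- by exists (k^-1)%g; [exact: permK|exact: permKV].
- move=> n R w; split; first exact: sym_rel.
  by move=> /(sym_rel (symV sk)); rewrite wK /= permRK.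
- move=> n F w u; split; first exact: sym_fun.
  by move=> /(sym_fun (symV sk)); rewrite wK /= permFK permK.
Qed.

Lemma chart_embedding : embedding Gam A B (GMap (lperm1 L) ch).
Proof.
apply/embeddingP; split=> /=; [exact: pg1|exact: chart_inj| |].
- by move=> n R x; rewrite -chart_rel.
- by move=> n F x u; rewrite -chart_fun.
Qed.

Definition copy (h : {perm S}) : set S := fun u => exists v, u = h (ch v).

Lemma copy_pick h n (w : 'I_n -> S) : (forall j, copy h (w j)) ->
  exists x, w = (fun j => h (ch (x j))).
Proof. by move=> /choice[x xE]; exists x; apply: funext. Qed.

Lemma copy_closed g h : sym g h -> funstable B (copy h).
Proof.
move=> sh n F w u /copy_pick[x ->] /(cover_fun _ _ _ sh)[y _ <-].
by exists y.
Qed.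

(** The traces of the copies on C are closed and contain all points and related tuples of C. By
    [irreducible_linked] the image of C is a clique, and conformality puts it into a copy. *)
Lemma irreducible_copied (T : Type) (C : lstruct L T) (e : gmap L T S) :
  conformal S -> (forall x : S, adj x x) -> embedding Gam C B e ->
  irreducible Gam C -> exists g h, sym g h /\ forall c, copy h (vpart e c).
Proof.
move=> cS cov /embeddingP[_ _ er ef] irr.
pose K k := exists g h, sym g h /\ k = (fun c => copy h (vpart e c)).
have link := @irreducible_linked L Gam T C K L_unary irr.
have [|g [h [sh hC]]] := cS [set x | `[< exists c, vpart e c = x >]].
  move=> _ _ /[!inE] /asboolP[c <-] /asboolP[d <-].
  have [|||k [[g [h [sh ->]]] [v ec] [w ed]]] := link _ _ _ c d.
  - move=> _ [g [h [sh ->]]] n F x y xk Fy.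
    have Fe : funI B (permF (lpart e) F) (vpart e \o x) (vpart e y).
      by apply/ef; exists y.
    by apply: (copy_closed sh _ Fe).
  - move=> x; have [g [h [v [_ [sh ex _]]]]] := cov (vpart e x).
    by exists (fun c => copy h (vpart e c)); [exists g, h|exists v].
  - move=> n R x /er [g [h [y [sh ey _]]]].
    exists (fun c => copy h (vpart e c)); first by exists g, h.
    by move=> j; exists (y j); have := congr1 (@^~ j) ey.
  - by exists g, h, v, w.
exists g, h; split=> // c; apply: hC; rewrite inE; apply/asboolP; by exists c.
Qed.

(** Each related tuple, and each tuple with a function value, has its image in a copy, and there the
    realization m is a copy of A moved by an automorphism of M with the right label; hence m is a
    homomorphism. An irreducible substructure of F embeds in B, so it lies in one copy, and on that
    copy m inherits injectivity, relations and function values. *)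
Lemma cover_forb (U : Type) (M : lstruct L U) (i : V -> U) n
    (T : finType) (F : lstruct L T) (f : gmap L T S) :
  conformal S -> (forall x : S, adj x x) ->
  embedding Gam A M (GMap (lperm1 L) i) ->
  realizable i (fun g t => automorphism Gam M (GMap g t)) S n ->
  #|{: T * T}| <= n -> hom_embedding Gam F B f ->
  exists f' : gmap L T U, hom_embedding Gam F M f'.
Proof.
move=> cS cov /embeddingP[_ ii ir iF] rS le_n [[fG fr ff] fe].
have [||m mE] := rS T (vpart f); first by move=> x; apply: cov.
  by apply: leq_trans le_n; rewrite cardsE; apply: max_card.
have mcomp h t n' (x : 'I_n' -> T) v : 
    (forall x v, x \in [set: T] -> vpart f x = h (ch v) -> m x = t (i v)) ->
    vpart f \o x = (fun j => h (ch (v j))) -> m \o x = t \o (i \o v).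
  move=> tE e; apply: funext => j /=; apply: tE => //.
  exact: (congr1 (@^~ j) e).
exists (GMap (lpart f) m); split.
  split=> //= [n' R x /fr[g [h [v [sh e Rv]]]]|n' Fs x _ [y Fy <-]].
    have [t /automorphismP[_ _ tr _] tE] := mE _ _ sh.
    rewrite (mcomp h t _ _ _ tE e) -[permR _ _](permRVK g) -tr.
    by apply/(ir _ (permRV g _)).
  have [g [h [v [z [sh e ez Fz]]]]] := ff _ Fs x _ (ex_intro2 _ _ _ Fy erefl).
  have [t /automorphismP[_ _ _ tF] tE] := mE _ _ sh.
  rewrite (mcomp h t _ _ _ tE e) (tE _ _ _ ez) // -[permF _ _](permFVK g) -tF.
  by apply/(iF _ (permFV g _)); exists z.
move=> X sX irr; have emb := fe X sX irr.
have [g [h [sh hX]]] := irreducible_copied cS cov emb irr.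
have [t /automorphismP[_ [t' tK t'K] tr tF] tE] := mE _ _ sh.
have [v vE] := choice hX.
have mv x : m (val x) = t (i (v x)) by apply: tE => //; apply: vE.
have mcv n' (x : 'I_n' -> X) : 
    (m \o (fun y : X => val y)) \o x = t \o (i \o (v \o x)).
  by apply: funext => j /=; rewrite mv.
have fcv n' (x : 'I_n' -> X) : vpart (gcomp f (inclusion L X)) \o x =
    (fun j => h (ch ((v \o x) j))).
  by apply: funext => j /=; rewrite -vE.
move/embeddingP: emb => [_ fi er eF]; apply/embeddingP; split=> //=.
- by rewrite lpermM1.
- move=> x y; rewrite /= !mv => /(can_inj tK)/ii e; apply: fi.
  by rewrite !vE e.
- move=> n' R x; apply: (iff_trans (er n' R x)); rewrite fcv (cover_rel _ _ sh) mcv.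
  by apply: (iff_trans (ir _ _ (v \o x))); rewrite tr /= permRVK.
- move=> n' Fs x u; have fun_fv w := cover_fun (permF (lpart f) Fs) (v \o x) w sh.
  rewrite mcv -[permF _ _](permFVK g); split=> [Fu|[y /= Fy <-]].
    move: Fu; rewrite -{1}(t'K u) -tF => /iF[z Fz /= iz].
    have /fun_fv : exists2 y, funI A (permFV g (permF (lpart f) Fs)) (v \o x) y &
      h (ch y) = h (ch z) by exists z.
    rewrite -fcv => /eF[y Fy yz]; exists y => //.
    by rewrite (tE (val y) z) // iz t'K.
  have : funI B (permF (lpart f) Fs) (vpart (gcomp f (inclusion L X)) \o x)
    (vpart (gcomp f (inclusion L X)) y) by apply/eF; exists y.
  rewrite fcv => /fun_fv[z Fz ez]; rewrite (tE (val y) z) // -tF.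
  by apply/(iF _ (permFV g _)); exists z.
Qed.

End CoverStructure.

(** * Coherent automorphisms of the cover *)

Section PartialAutConversion.
Variables (L : language) (Gam : perm_group L) (V : finType) (A : lstruct L V).

(** Brings the hypothesis on M to the form of [MA_ext], passing from a total map with a finite
    domain to a map between subtypes. *)
Lemma pa_extends (U : Type) (M : lstruct L U) (i : V -> U) g X q :
  extends_partial_auts Gam A M i -> pa Gam A g X q ->
  exists2 t, automorphism Gam M (GMap g t) & {in X, forall x, t (i x) = i (q x)}.
Proof.
move=> ext p; have [G p'] := p; have cX := pa_closed p.
have cY := piso_im_closed p'.
pose X' : set V := fun v => v \in X; pose Y' : set V := fun v => v \in q @: X.
have qY (x : X') : Y' (q (val x)) by apply/imset_f/(set_valP x).
pose f (x : X') : Y' := exist _ (q (val x)) (mem_set (qY x)).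
have f_inj : injective f.
  move=> x y /(congr1 val) /= e; apply: val_inj.
  by apply: (pa_inj p) => //; [exact: (set_valP x)|exact: (set_valP y)].
have f_surj (y : Y') : exists x, f x = y.
  have /imsetP[x xX e] := set_valP y.
  by exists (exist _ x (mem_set xX)); apply: val_inj; rewrite /= e.
have [f' f'K] := choice f_surj.
have fb : bijective f by exists f' => // x; apply: f_inj.
have xX n (x : 'I_n -> X') j : val (x j) \in X by apply: (set_valP (x j)).
have [|[g' t] [Mt [/= eg tE]]] := ext X' Y' (GMap g f).
  apply/partial_autP; split=> //.
  - move=> n R x /=; have := piso_rel p' (permR g R) (xX n x).
    by rewrite /= permRK.
  - move=> n F x y /=; split=> Fy.
      have := piso_fun p' (F := permF g F) (xX n x); rewrite /= permFK; exact.
    have [z + e] := piso_funV p' (F := permF g F) (xX n x) Fy.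
    rewrite /= permFK => Fz.
    suff -> : val y = z by [].
    apply: (pa_inj p) => //; first exact: (set_valP y).
    by apply: cX Fz => j; apply: xX.
exists t => [|x xX']; first by rewrite -eg.
exact: tE (exist _ x (mem_set xX')).
Qed.

End PartialAutConversion.

Section CoverExtension.
Variables (L : language) (Gam : perm_group L) (V : finType) (A : lstruct L V).
Variable S : system Gam A.
Local Notation ch := (chart S).
Local Notation B := (cover_struct S).
Local Notation psi := (GMap (lperm1 L) ch).
Local Notation P := (range (vpart psi)).
Implicit Types X Y Z : set P.

(** Partial automorphisms of the image of A are pulled back along the chart to a domain and a total
    map on V; off the domain the map is arbitrary. *)
Definition chart_dom X : {set V} :=
  [set v | `[< exists x : X, val (val x) = ch v >]].

Lemma chart_fun_ex X Y (f : gmap L X Y) : exists q : V -> V,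
  forall v x, val (val x) = ch v -> val (val (vpart f x)) = ch (q v).
Proof.
suff /choice[q qE] : forall v, exists w, forall x,
    val (val x) = ch v -> val (val (vpart f x)) = ch w by exists q.
move=> v; have [[x xv]|no] := pselect (exists x : X, val (val x) = ch v); last first.
  by exists v => x xv; case: no; exists x.
have [w _ wE] := set_valP (val (vpart f x)); exists w => y yv.
by have -> : y = x by apply/val_inj/val_inj; rewrite yv xv.
Qed.

Definition chart_map X Y (f : gmap L X Y) := sval (cid (chart_fun_ex f)).

Lemma chart_mapE X Y (f : gmap L X Y) v x :
  val (val x) = ch v -> val (val (vpart f x)) = ch (chart_map f v).
Proof. by rewrite /chart_map; case: cid => q /= qE; apply: qE. Qed.

Lemma chart_domP X v : reflect (exists x : X, val (val x) = ch v) (v \in chart_dom X).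
Proof. by rewrite inE; apply: asboolP. Qed.

Lemma chart_dom_ex X (x : X) : exists2 v, v \in chart_dom X & val (val x) = ch v.
Proof.
have [v _ e] := set_valP (val x); exists v => //.
by apply/chart_domP; exists x.
Qed.

Lemma chart_lift X n (t : 'I_n -> V) : (forall j, t j \in chart_dom X) ->
  exists x : 'I_n -> X, (fun j => val (val (x j))) = (fun j => ch (t j)).
Proof.
move=> tX; have /choice[x xE] : forall j, exists x : X, val (val x) = ch (t j).
  by move=> j; apply/chart_domP.
by exists x; apply: funext.
Qed.

Lemma chart_map_pa X Y (f : gmap L X Y) :
  partial_aut Gam (image_struct B psi) f ->
  pa Gam A (lpart f) (chart_dom X) (chart_map f).
Proof.
move=> /partial_autP[G [cX cY] [f' fK f'K] fr0 ff0].
(* [image_struct] is an induced structure, so its relations and functions are by conversion those of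
   B on the underlying points. *)
have fr n (R : relsym L n) (x : 'I_n -> X) :
    relI B R (fun j => val (val (x j))) <->
    relI B (permR (lpart f) R) (fun j => val (val (vpart f (x j)))) := fr0 n R x.
have ff n (F : funsym L n) (x : 'I_n -> X) (y : X) :
    funI B F (fun j => val (val (x j))) (val (val y)) <->
    funI B (permF (lpart f) F) (fun j => val (val (vpart f (x j))))
      (val (val (vpart f y))) := ff0 n F x y.
have dom_closed : funclosed A (chart_dom X).
  move=> n F t y tX Fy; have [x xE] := chart_lift tX.
  pose py : P := exist _ (ch y) (mem_set (ex_intro2 _ _ y I erefl)).
  have Xy : X py.
    apply: (cX n F (fun j => val (x j)) py); first by move=> j; apply: (set_valP (x j)).
    by rewrite /= xE; apply/chart_fun; exists y.
  by apply/chart_domP; exists (exist _ py (mem_set Xy)).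
have fE n (t : 'I_n -> V) (x : 'I_n -> X) :
    (fun j => val (val (x j))) = (fun j => ch (t j)) ->
    (fun j => val (val (vpart f (x j)))) = (fun j => ch ((chart_map f \o t) j)).
  move=> xE; apply: funext => j /=; apply: chart_mapE.
  exact: (congr1 (@^~ j) xE).
split=> //; split; first by rewrite -funclosed_relabel.
- move=> v w /chart_domP[x xv] /chart_domP[y yw] e.
  have xy : x = y.
    apply: (can_inj fK); apply/val_inj/val_inj.
    by rewrite (chart_mapE f xv) (chart_mapE f yw) e.
  by apply: (@chart_inj _ _ _ _ S); rewrite -xv xy.
- move=> n R t tX; have [x xE] := chart_lift tX.
  have := fr n (permRV (lpart f) R) x; rewrite permRVK xE (fE _ _ _ xE).
  by rewrite !chart_rel.
- move=> n F t y tX Fy; have [x xE] := chart_lift tX.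
  have /chart_domP[z zy] : y \in chart_dom X.
    by apply: dom_closed tX Fy.
  have := ff n (permFV (lpart f) F) x z.
  rewrite permFVK xE (fE _ _ _ xE) (chart_mapE f zy) zy !chart_fun => -[+ _].
  by case; [exists y|move=> y' Fy' /chart_inj <-].
- move=> n F t z tX Fz; have [x xE] := chart_lift tX.
  pose pz : P := exist _ (ch z) (mem_set (ex_intro2 _ _ z I erefl)).
  have Yz : Y pz.
    apply: (cY n F (fun j => val (vpart f (x j))) pz).
      by move=> j; apply: (set_valP (vpart f (x j))).
    by rewrite /= (fE _ _ _ xE); apply/chart_fun; exists z.
  pose w := f' (exist _ pz (mem_set Yz)).
  have fw : val (val (vpart f w)) = ch z by rewrite f'K.
  have := ff n (permFV (lpart f) F) x w.
  rewrite permFVK xE (fE _ _ _ xE) fw !chart_fun => -[_].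
  case; first by exists z.
  move=> y Fy wy; exists y => //; apply: (@chart_inj _ _ _ _ S).
  by rewrite -fw; apply: chart_mapE.
Qed.

Definition cover_hat X Y (f : gmap L X Y) : gmap L S S :=
  GMap (lpart f)
    (hat S (chart_dom X) (coextp (chart_dom X) (chart_map f)) (lpart f)).

Lemma coextp_pa X Y (f : gmap L X Y) :
  partial_aut Gam (image_struct B psi) f ->
  pa Gam A (lpart f) (chart_dom X) (coextp (chart_dom X) (chart_map f)).
Proof.
move=> /chart_map_pa p; apply: (eq_pa _ p) => v vX.
by rewrite coextpE //; exact: pa_inj p.
Qed.

Lemma cover_hat_extends X Y (f : gmap L X Y) :
  partial_aut Gam (image_struct B psi) f ->
  automorphism Gam B (cover_hat f) /\ extends (fun y : P => val y) f (cover_hat f).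
Proof.
move=> pf; have p := coextp_pa pf; split.
  by apply: sym_automorphism; apply: hat_sym.
split=> // x; have [v vX e] := chart_dom_ex x.
rewrite /= e (hatE S p) // coextpE //; first exact/esym/chart_mapE.
exact: pa_inj (chart_map_pa pf).
Qed.

(** Coherence combines two functorial extensions: [coextp] from a partial map to a permutation of V,
    and [hat] from there to a symmetry of the cover. *)
Lemma cover_hat_comp X Y Z (f : gmap L X Y) (g : gmap L Y Z) :
  partial_aut Gam (image_struct B psi) f ->
  partial_aut Gam (image_struct B psi) g ->
  cover_hat (gcomp g f) = gcomp (cover_hat g) (cover_hat f).
Proof.
move=> pf pg; have p := chart_map_pa pf; have q := chart_map_pa pg.
have im : chart_map f @: chart_dom X = chart_dom Y.
  have [_ _ [f' fK f'K] _ _] := (partial_autP _ _ _).1 pf.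
  apply/setP => v; apply/imsetP/chart_domP.
    move=> [u /chart_domP[x xu] ->]; exists (vpart f x); exact: chart_mapE.
  move=> [y yv]; have [u uX xu] := chart_dom_ex (f' y); exists u => //.
  apply: (@chart_inj _ _ _ _ S); rewrite -yv -(chart_mapE f xu).
  by rewrite f'K.
have im' : coextp (chart_dom X) (chart_map f) @: chart_dom X = chart_dom Y.
  by rewrite -im; apply: eq_in_imset => v vX; rewrite coextpE //; apply: pa_inj p.
have comp : coextp (chart_dom X) (chart_map (gcomp g f)) =
    (coextp (chart_dom X) (chart_map f) * coextp (chart_dom Y) (chart_map g))%g.
  rewrite -im -coextp_comp ?im; [|exact: pa_inj p|exact: pa_inj q].
  apply: eq_coextp => v /chart_domP[x xv]; apply: (@chart_inj _ _ _ _ S).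
  rewrite -(chart_mapE (gcomp g f) xv).
  exact: (chart_mapE g (chart_mapE f xv)).
rewrite /cover_hat /gcomp /= comp; congr GMap.
have pg' : pa Gam A (lpart g) (coextp (chart_dom X) (chart_map f) @: chart_dom X)
    (coextp (chart_dom Y) (chart_map g)) by rewrite im'; apply: coextp_pa.
rewrite (hatM S (coextp_pa pf) pg') im'.
by apply: funext => x; rewrite permM.
Qed.

End CoverExtension.

(** * Assembling the cover and checking the required properties *)

Theorem theorem1p5 (L : language) (Gam : perm_group L)
  (L_unary : forall n, funsym L n -> n = 1)
  (I : finType) (VF : I -> finType) (Fam : forall i : I, lstruct L (VF i))
  (V : finType) (A : lstruct L V)
  (A_Forb : Forb_he Gam Fam A)
  (A_orbit : finite_set (relabel_orbit Gam A)) :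
  (exists (U : countType) (M : lstruct L U) (i : V -> U),
     [/\ Forb_he Gam Fam M,
         embedding Gam A M (GMap (lperm1 L) i) &
         extends_partial_auts Gam A M i]) ->
  exists (W : finType) (B : lstruct L W),
    Forb_he Gam Fam B /\ irr_faithful_coherent_eppa_witness Gam A B.
Proof.
move=> [U [M [i [M_Forb iM iext]]]].
have [O [dec [o0 [lab [dec_inj dec0 labE]]]]] := orbit_code A_orbit.
pose S0 := base_system L_unary dec_inj dec0 labE.
pose MA g t := automorphism Gam M (GMap g t).
(* The bound dominates the number of pairs of points in each member of the family, hence the number
   of non-adjacent pairs of any map from it to the cover. *)
have [S1 [cS1 rS1]] := realizable_ex L_unary
  (@automorphism_comp L Gam U M) (@automorphism_inv L Gam U M)
  (fun g X q => pa_extends iext) S0 (\sum_(j : I) #|{: VF j * VF j}|).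
pose S := restriction S1.
have cS : conformal S := restriction_conformal cS1.
have rS := restriction_realizable rS1.
have cov (x : S) : adj x x := adj_restriction x.
exists S, (cover_struct S); split.
  move=> j [f fB]; apply: (M_Forb j).
  apply: (cover_forb L_unary cS cov iM rS _ fB).
  by rewrite (bigD1 j) //= leq_addr.
exists (GMap (lperm1 L) (chart S)); split.
- split; first exact: chart_embedding.
  by move=> X Y f pf; exists (cover_hat f); apply: cover_hat_extends.
- exists (@cover_hat _ _ _ _ S); split; first exact: cover_hat_extends.
  exact: cover_hat_comp.
move=> X sX irr.
have [g [h [sh hX]]] := irreducible_copied L_unary cS cov sX irr.
(* X lies in the copy of h, so the inverse of h takes it into the chart. *)
exists (GMap (lpermV g) (h^-1)%g); split; first exact/sym_automorphism/symV.
move=> _ [x Xx <-] /=; have [v e] := hX (exist _ x (mem_set Xx)).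
by exists v => //; rewrite (_ : x = h (chart S v)) ?permK.
Qed.
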